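(* Let $d>1$. Given a set $P\subset\mathbb{Z}^d$ of zero upper-Banach density, there exist a totally strictly ergodic $\mathbb{Z}^d$-action $(X,\mathcal{B},\mu,T)$ and an uncountable set $X_0\subset X$ for which $$x\notin\overline{\{T^{p_n}x : n\ge 1\}}\quad\text{for every } x\in X_0,$$ where $P=\{p_n : n\ge 1\}$. In addition, $(X,\mathcal{B},\mu,T)$ can have arbitrarily large topological entropy.
   Context: The elements of $P$ are listed as $p_1,p_2,\dots$, so that $\{T^{p_n}x : n\ge 1\}=\{T^px : p\in P\}$. $[r,r+n)=\{r,\dots,r+n-1\}$ denotes an integer interval. The upper-Banach density of $P\subset\mathbb{Z}^d$ is $d^*(P)=\limsup_{n_1,\dots,n_d\to+\infty}\ \sup_{(r_1,\dots,r_d)\in\mathbb{Z}^d}\frac{|P\cap [r_1,r_1+n_1)\times\cdots\times[r_d,r_d+n_d)|}{n_1\cdots n_d}$. Here $X$ is a compact metric space with Borel $\sigma$-algebra $\mathcal{B}$, $T$ is an action of $\mathbb{Z}^d$ on $X$ by homeomorphisms, and $T^g:X\to X$ is the map associated with $g\in\mathbb{Z}^d$. For a subgroup $F\le\mathbb{Z}^d$, $T|_F$ denotes the restricted $F$-action. An action of $F$ is minimal if every orbit is dense, uniquely ergodic if it has exactly one invariant Borel probability measure, and strictly ergodic if it is both. The $\mathbb{Z}^d$-action is totally strictly ergodic if, for every subgroup $F\le\mathbb{Z}^d$ of finite index, $(X,T|_F)$ is strictly ergodic. The measure $\mu$ is the unique $T$-invariant Borel probability measure. $h(X,T)$ denotes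 the topological entropy of the $\mathbb{Z}^d$-action; for a subshift (a closed shift-invariant $X\subset\mathcal{C}^{\mathbb{Z}^d}$, $\mathcal{C}$ a finite alphabet, with $(T^gx)(h)=x(g+h)$) it is $h(X,T)=\lim_{n\to\infty} n^{-d}\log\left|\{x|_{[0,n)^d} : x\in X\}\right|$. ''Arbitrarily large topological entropy'' means that for every real $M\ge 0$ such an action and set $X_0$ can be chosen with $h(X,T)\ge M$.
   Formalization: The formal theorem additionally assumes that 0 is not in P; without this the claim fails (e.g. P = {0}), since T^0 x = x always lies in the closure of {T^p x : p in P}. *)

(* Defs.v *)
From HB Require Import structures.
From mathcomp Require Import all_boot all_order all_algebra finmap.
From mathcomp Require Import all_classical all_reals all_analysis.
Set Implicit Arguments.
Unset Strict Implicit.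
Unset Printing Implicit Defensive.
Import Order.TTheory GRing.Theory Num.Theory.
Local Open Scope classical_set_scope.
Local Open Scope ring_scope.

(* Measurable types are pointed in MathComp-Analysis, so the Borel
   sigma-algebra of a metric space is available on pointed spaces only. *)
#[short(type="pmetricType")]
HB.structure Definition PointedMetric (K : numDomainType) :=
  {M of Metric K M & isPointed M}.

(* The group Z^d is 'rV[int]_d. *)

Definition zbox (d : nat) (r : 'rV[int]_d) (n : 'rV[nat]_d) : set 'rV[int]_d :=
  [set g | forall i, r 0 i <= g 0 i < r 0 i + (n 0 i)%:Z].

Definition upper_banach_density (R : realType) (d : nat)
    (P : set 'rV[int]_d) : \bar R :=
  limf_esup
    (fun n : 'rV[nat]_d =>
      ereal_sup
        [set ((#|` fset_set (P `&` zbox r n)|)%:R / (\prod_i n ord0 i)%:R : R)%:E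
        | r in [set: 'rV[int]_d]])
    (* the filter of "n_1, ..., n_d --> +oo" *)
    (filter_from [set: nat]
      (fun N => [set n : 'rV[nat]_d | forall i, (N <= n ord0 i)%N])).

Definition is_subgroup (d : nat) (F : set 'rV[int]_d) : Prop :=
  F 0 /\ forall g h, F g -> F h -> F (g - h).

Definition finite_index (d : nat) (F : set 'rV[int]_d) : Prop :=
  finite_set (range (fun g : 'rV[int]_d => [set g + f | f in F])).

Section actions.
Variables (R : realType) (d : nat) (X : pmetricType R).
Implicit Types (T : 'rV[int]_d -> X -> X) (F : set 'rV[int]_d).

(* T g is then a homeomorphism, with inverse T (- g). *)
Definition is_action T : Prop :=
  [/\ forall x, T 0 x = x,
      forall g h x, T (g + h) x = T g (T h x)
    & forall g, continuous (T g)].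

Definition minimal T F : Prop :=
  forall x, dense [set T f x | f in F].

Definition borel := g_sigma_algebraType (@open X).

Definition invariant_measure T F (mu : probability borel R) : Prop :=
  forall f (A : set borel), F f -> measurable A ->
    mu (T f @^-1` A) = mu A.

(* Measures are compared on measurable sets only: the library's measures are
   total functions on [set borel], arbitrary outside the sigma-algebra. *)
Definition unique_invariant T F (mu : probability borel R) : Prop :=
  invariant_measure T F mu /\
  forall nu : probability borel R, invariant_measure T F nu ->
    forall A : set borel, measurable A -> nu A = mu A.

Definition uniquely_ergodic T F : Prop :=
  exists mu : probability borel R, unique_invariant T F mu.

Definition strictly_ergodic T F : Prop :=
  minimal T F /\ uniquely_ergodic T F.

Definition totally_strictly_ergodic T : Prop :=
  forall F, is_subgroup F -> finite_index F -> strictly_ergodic T F.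

(* Topological entropy in the sense of Bowen, along the cubes [0, n)^d. *)

Definition eps_separated T (n : nat) (eps : R) (E : {fset X}) : Prop :=
  forall x y, x \in E -> y \in E -> x != y ->
    exists2 g, zbox 0 (const_mx n) g & eps < mdist (T g x) (T g y).

Definition separation_number T (n : nat) (eps : R) : \bar R :=
  ereal_sup [set (#|` E|%:R : R)%:E | E in eps_separated T n eps].

(* The growth rate is nonincreasing in eps, so that the supremum over eps > 0
   is the limit as eps --> 0+. *)
Definition topological_entropy T : \bar R :=
  ereal_sup
    [set limn_esup (fun n : nat =>
           (((n ^ d)%:R^-1 : R)%:E * lne (separation_number T n eps))%E)
    | eps in [set eps : R | 0 < eps]].

End actions.

(* Main.v *)
(* The system is a subshift assembled from finite blocks. A block of level
   [k + 1] is a cube of cells, each cell holding a block of level [k]; every block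
   of level [k] is used equally often in the cells of each residue class modulo
   [k!]. At every other level the cells are separated by layers of thickness one
   of a filler letter, so that the distance between the corners of adjacent cells
   is [+1] or [-1] modulo [k!]. Hence, inside any block, the occurrences of a pattern are
   equidistributed among the residue classes modulo any [m], up to boundary
   effects that vanish as the level grows; this gives minimality and unique
   ergodicity of all the subgroups [m Z^d] at once. The invariant measure is
   obtained from the limiting frequencies by Caratheodory extension.
   A balanced arrangement can be prescribed on any small set of cells, in
   particular on the few cells that meet [P]: some points carry a distinguished letter at
   the origin and nowhere on [P], and a diagonal argument yields uncountably many
   of them. The number of blocks is almost the number of all arrangements, so
   almost no entropy is lost from one level to the next. *)
From HB Require Import structures.
Require Import Defs.
From mathcomp Require Import all_boot all_order perm all_algebra finmap.
From mathcomp Require Import all_classical all_reals all_analysis measurable_realfun.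
From mathcomp Require Import zify lra.
Set Implicit Arguments.
Unset Strict Implicit.
Unset Printing Implicit Defensive.
Import Order.TTheory GRing.Theory Num.Theory.
Import numFieldNormedType.Exports.
Local Open Scope ring_scope.

(** * Balanced arrangements *)

(** Alternation leaves the defect of one that makes the gap a unit. The three factors of [width k]
    have separate duties. The number of blocks makes each class of cells divisible among the blocks,
    the factorial makes the classes equally large, and [sel] is a free parameter, chosen once the
    stage is known. It is taken so large that P becomes rare on the scale of a block and that the
    entropy lost is below the slack still available. Its lower bound 3 makes cell 1 an interior
    cell, so that blocks nested in it fill the whole group. A block may sit anywhere relative to P,
    so P must be rare in every translate of a cube; this is what the supremum over translates in the
    upper Banach density provides. *)

Section balanced.
Variables (C D S : finType) (cls : C -> D) (l : nat).
Implicit Types (f : {ffun C -> S}).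

Definition balanced f :=
  [forall t, [forall w, #|[set c | (cls c == t) && (f c == w)]| == l]].

Lemma balancedP f : reflect
  (forall t w, #|[set c | (cls c == t) && (f c == w)]| = l) (balanced f).
Proof.
apply: (iffP forallP) => [fb t w|fb t]; first by have /forallP/(_ w)/eqP := fb t.
by apply/forallP => w; rewrite fb.
Qed.

(** The right side does not mention [f]: a statistic that sees a cell only through its value and its
    class is the same for all balanced arrangements. This is the source of unique ergodicity. *)
Lemma balanced_sum f (psi : S -> D -> nat) : balanced f ->
  (\sum_c psi (f c) (cls c) = l * \sum_w \sum_t psi w t)%N.
Proof.
move=> /balancedP fb; rewrite (partition_big f xpredT)//= big_distrr /=.
apply: eq_bigr => w _; rewrite (partition_big cls xpredT)//= big_distrr /=.
apply: eq_bigr => t _; rewrite -(fb t w) -sum1_card big_distrl /=.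
apply: eq_big => c; first by rewrite inE andbC.
by move=> /andP[/eqP -> /eqP ->]; rewrite mul1n.
Qed.

(* A disagreement at [c] is removed by exchanging the values at [c] and at some
   cell of the same class, outside [B], that carries the wanted value. *)
Lemma balanced_extend f0 (B : {set C}) (g : C -> S) :
  balanced f0 -> (#|B| <= l)%N ->
  exists2 f, balanced f & forall c, c \in B -> f c = g c.
Proof.
move=> f0b Bl; pose bad f := #|[set c in B | f c != g c]|.
elim: {f0 f0b}(bad f0).+1 {-2}f0 (ltnSn (bad f0)) f0b => // n IH f0 f0n f0b.
have [/existsP[c /andP[cB fc]]|/existsPn ok] := boolP [exists c, (c \in B) && (f0 c != g c)];
    last first.
  exists f0 => // c cB; apply/eqP; have := ok c; rewrite cB /=.
  by move/negbNE.
(* The cells of this class that carry [g c] number [l], while [B] without [c] has fewer than [l]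
   elements. *)
have [c' [c'B clsc' fc']] : exists c', [/\ c' \notin B, cls c' = cls c & f0 c' = g c].
  have /subsetPn[c'] : ~~ ([set c' | (cls c' == cls c) && (f0 c' == g c)] \subset B :\ c).
    apply/negP => /subset_leq_card; move/balancedP: (f0b) => ->.
    by rewrite leqNgt; move: Bl; rewrite (cardsD1 c B) cB => ->.
  rewrite !inE => /andP[/eqP cc' /eqP fc']; rewrite negb_and negbK => /orP[/eqP E|c'B].
    by move: fc; rewrite -fc' E eqxx.
  by exists c'.
pose f := [ffun x => f0 (tperm c c' x)].
have clsT x : cls (tperm c c' x) = cls x by case: tpermP => // ->.
apply: (IH f).
  rewrite -ltnS; apply: leq_trans f0n; rewrite ltnS.
  apply: proper_card; apply/properP; split.
    apply/fintype.subsetP => x; rewrite !inE ffunE => /andP[xB].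
    rewrite xB /=; case: tpermP => [->|xc'|] //.
    by move: xB; rewrite xc' (negbTE c'B).
  by exists c; rewrite !inE ?cB//= ffunE tpermL fc' eqxx.
apply/balancedP => t w; move/balancedP: f0b => /(_ t w) <-.
rewrite -(card_imset _ (@perm_inj _ (tperm c c'))); apply: eq_card => x.
apply/imsetP/idP => [[y]|]; rewrite !inE.
  by rewrite ffunE => /andP[/eqP <- /eqP <-] ->; rewrite clsT !eqxx.
move=> /andP[/eqP <- /eqP <-]; exists (tperm c c' x); last by rewrite tpermK.
by rewrite inE ffunE clsT tpermK !eqxx.
Qed.

End balanced.

(* The words of length [n] are sorted by the numbers of occurrences of the
   letters; a largest class [F] is raised to the power [#|D| * #|S|], and the
   copies of [F] attached to the various [j] are shifted cyclically by [j], which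
   equalises the numbers of occurrences. *)
Lemma card_balanced (C D S : finType) (cls : C -> D) (n : nat) :
  (0 < #|S|)%N ->
  (forall t, #|[set c | cls c == t]| = #|S| * n)%N ->
  (#|S| ^ (n * (#|D| * #|S|)) <= n.+1 ^ (#|S| * (#|D| * #|S|)) *
    #|[set f : {ffun C -> S} | balanced cls n f]|)%N.
Proof.
case s0 : #|S| => [//|s] _ fib.
pose e (w : S) : 'I_s.+1 := cast_ord s0 (enum_rank w).
pose e' (j : 'I_s.+1) : S := enum_val (cast_ord (esym s0) j).
have eK : cancel e e' by move=> w; rewrite /e' /e cast_ordK enum_rankK.
have e'K : cancel e' e by move=> w; rewrite /e' /e enum_valK cast_ordKV.
pose act (j : 'I_s.+1) (w : S) : S := e' (e w + j).
have act_inj j : injective (act j).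
  by move=> w w' /(can_inj e'K) /addIr /(can_inj eK).
have act_card w w' : #|[set j | act j w' == w]| = 1%N.
  rewrite (_ : [set j | _] = [set e w - e w']) ?cards1//.
  apply/setP => j; rewrite !inE -(inj_eq (can_inj eK)) /act e'K.
  by rewrite -subr_eq0 -[RHS]subr_eq0 opprB addrA [j + _]addrC.
pose typ (h : {ffun 'I_n -> S}) : {ffun S -> 'I_n.+1} :=
  [ffun w => inord #|[set i | h i == w]|].
have typE h w : typ h w = #|[set i | h i == w]| :> nat.
  by rewrite ffunE inordK// ltnS -[leqRHS]card_ord max_card.
(* Pigeonhole over the [n.+1 ^ s.+1] candidate types. *)
have [t tbig] : exists t, (s.+1 ^ n <= n.+1 ^ s.+1 * #|[set h | typ h == t]|)%N.
  have [t0 tmax] : exists t0, forall t,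
      (#|[set h | typ h == t]| <= #|[set h | typ h == t0]|)%N.
    exists [arg max_(t > [ffun=> ord0]) #|[set h | typ h == t]|]%N.
    by case: arg_maxnP => // i _ H t; exact: H.
  exists t0; have -> : (s.+1 ^ n = \sum_t #|[set h | typ h == t]|)%N.
    rewrite -s0 -[n in LHS]card_ord -card_ffun -sum1_card.
    rewrite (partition_big typ xpredT)//=; apply: eq_bigr => t _.
    by rewrite -sum1_card; apply: eq_bigl => h; rewrite inE.
  apply: (@leq_trans (\sum_(t : {ffun S -> 'I_n.+1}) #|[set h | typ h == t0]|)).
    exact: leq_sum.
  by rewrite sum_nat_const card_ffun card_ord s0.
pose F := {h | typ h == t}.
have FE (h : F) w : t w = #|[set i | sval h i == w]| :> nat.
  by rewrite -typE (eqP (svalP h)).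
have cardF : #|{: F}| = #|[set h | typ h == t]|.
  by rewrite card_sig; apply: eq_card => h; rewrite !inE.
have fib' u : size (enum [set c | cls c == u]) = (s.+1 * n)%N.
  by rewrite -cardE fib.
(* A cell is coordinatised by its class together with the quotient [J] and the remainder [I] of its
   rank in the class by [n]. *)
pose rk c := index c (enum [set c' | cls c' == cls c]).
have rk_lt c : (rk c < s.+1 * n)%N by rewrite -(fib' (cls c)) index_mem mem_enum inE.
have n0 (c : C) : (0 < n)%N by have := rk_lt c; case: (n); rewrite ?muln0.
have jP c : (rk c %/ n < s.+1)%N by rewrite ltn_divLR ?(n0 c).
have iP c : (rk c %% n < n)%N by rewrite ltn_mod (n0 c).
pose J c := Ordinal (jP c); pose I c := Ordinal (iP c).
pose Phi (phi : {ffun D * 'I_s.+1 -> F}) : {ffun C -> S} :=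
  [ffun c => act (J c) (sval (phi (cls c, J c)) (I c))].
have cellP u (p : 'I_s.+1 * 'I_n) :
    exists c, [/\ cls c = u, J c = p.1 & I c = p.2].
  have lt : (p.1 * n + p.2 < s.+1 * n)%N.
    have := ltn_ord p.1; have := ltn_ord p.2; nia.
  have c0 : C.
    have : (0 < size (enum [set c | cls c == u]))%N by rewrite fib' (leq_trans _ lt).
    by case: (enum _).
  pose c := nth c0 (enum [set c | cls c == u]) (p.1 * n + p.2).
  have : c \in enum [set c | cls c == u] by rewrite mem_nth// fib'.
  rewrite mem_enum inE => /eqP cu.
  have rkc : rk c = (p.1 * n + p.2)%N.
    by rewrite /rk cu /c index_uniq ?enum_uniq// fib'.
  exists c; split => //; apply: val_inj => /=; rewrite rkc.
    by rewrite divnMDl ?(n0 c)// divn_small ?addn0.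
  by rewrite modnMDl modn_small.
have cell_inj c c' : cls c = cls c' -> J c = J c' -> I c = I c' -> c = c'.
  move=> cc' /(congr1 val) /= jj /(congr1 val) /= ii.
  have : rk c = rk c' by rewrite (divn_eq (rk c) n) jj ii -divn_eq.
  rewrite /rk cc' => /(congr1 (nth c (enum [set c'' | cls c'' == cls c']))).
  by rewrite !nth_index// mem_enum inE// cc'.
have Phi_inj : injective Phi.
  move=> phi phi' /ffunP E; apply/ffunP => -[u j]; apply: val_inj.
  apply/ffunP => i; have [c [cu cj ci]] := cellP u (j, i).
  by have := E c; rewrite !ffunE cu cj ci /= => /act_inj.
have Phi_bal phi : balanced cls n (Phi phi).
  apply/balancedP => u w.
  pose G := [set p : 'I_s.+1 * 'I_n | act p.1 (sval (phi (u, p.1)) p.2) == w].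
  have -> : #|[set c | (cls c == u) && (Phi phi c == w)]| = #|G|.
    have inj : {in [set c | (cls c == u) && (Phi phi c == w)] &,
        injective (fun c => (J c, I c))}.
      move=> c c'; rewrite !inE => /andP[/eqP cu _] /andP[/eqP c'u _] [].
      by move=> jj ii; apply: cell_inj; rewrite ?cu ?c'u//; apply: val_inj.
    rewrite -(card_in_imset inj); apply: eq_card => -[j i].
    apply/imsetP/idP => [[c]|]; rewrite !inE.
      by rewrite ffunE => /andP[/eqP <- /eqP <-] ->.
    move=> /eqP <- /=; have [c [cu cj ci]] := cellP u (j, i).
    exists c; last by rewrite cj ci.
    by rewrite inE ffunE cu cj ci !eqxx.
  transitivity (\sum_j #|[set i | act j (sval (phi (u, j)) i) == w]|)%N.
    rewrite -sum1_card (partition_big fst xpredT)//=; apply: eq_bigr => j _.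
    rewrite -sum1_card (reindex_onto (fun i => (j, i)) snd) /=; last first.
      by move=> [j' i] /andP[_ /eqP /= ->].
    by apply: eq_bigl => i; rewrite !inE !eqxx !andbT.
  transitivity (\sum_j \sum_w' (act j w' == w) * t w')%N.
    apply: eq_bigr => j _; rewrite -sum1_card.
    rewrite (partition_big (sval (phi (u, j))) xpredT)//=.
    apply: eq_bigr => w' _; rewrite (FE (phi (u, j))).
    have [aw|aw] := eqVneq (act j w') w; last first.
      rewrite mul0n big_pred0// => i; rewrite !inE.
      by apply/negbTE; rewrite negb_and orbC -implyNb negbK; apply/implyP => /eqP ->.
    rewrite mul1n -sum1_card; apply: eq_bigl => i; rewrite !inE.
    by rewrite andb_idl// => /eqP ->; apply/eqP.
  (* Exactly one shift takes [w'] to [w], so the count is the sum of all [t w'], the length [n] of a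
     word. *)
  rewrite exchange_big /=.
  transitivity (\sum_w' t w')%N.
    apply: eq_bigr => w' _; rewrite -big_distrl /= -[RHS]mul1n; congr (_ * _)%N.
    rewrite -(act_card w w') -sum1_card [RHS]big_mkcond /=; apply: eq_bigr => j _.
    by rewrite inE; case: eqP.
  have [phi0 _] : exists h : F, True by exists (phi (u, ord0)).
  transitivity (\sum_w' #|[set i | sval phi0 i == w']|)%N.
    by apply: eq_bigr => w' _; rewrite (FE phi0).
  rewrite -[RHS]card_ord -sum1_card (partition_big (sval phi0) xpredT)//=.
  by apply: eq_bigr => w' _; rewrite -sum1_card; apply: eq_bigl => i; rewrite inE.
have le1 : (#|{: F}| ^ (#|D| * s.+1) <=
    #|[set f : {ffun C -> S} | balanced cls n f]|)%N.
  rewrite -[X in (_ * X)%N]card_ord -card_prod -card_ffun -cardsT.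
  rewrite -(card_imset _ Phi_inj); apply: subset_leq_card.
  by apply/fintype.subsetP => f /imsetP[phi _ ->]; rewrite inE.
apply: leq_trans (leq_mul (leqnn _) le1).
rewrite expnM [X in (_ <= X * _)%N]expnM -expnMn cardF.
by case: (posnP (#|D| * s.+1)%N) => [->|e0]; rewrite ?expn0// leq_exp2r.
Qed.

(** * Towers of blocks *)

Section stages.
Variables (d : nat) (A : Type) (filler : A).
Notation pos := ('I_d -> nat).

(** [code] names the blocks, and [spacer] tells whether a layer of filler follows each block when it
    is used as a cell of the next stage. The values of [dec] matter only in the box of side
    [side]. *)
Record stage := Stage {
  side : nat;
  spacer : bool;
  code : finType;
  dec : code -> pos -> A }.

Definition gap (s : stage) : nat := (side s + spacer s)%N.

Definition cell (R : nat) := {ffun 'I_d -> 'I_R.+1}.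

Definition residue (M R : nat) (c : cell R) : {ffun 'I_d -> 'I_M.+1} :=
  [ffun i => inord (c i %% M.+1)].

Definition in_box (N : nat) (g : pos) := forall i, (g i < N)%N.

Definition next_code (s : stage) (M R l : nat) : finType :=
  {f : {ffun cell R -> code s} | balanced (@residue M R) l f}.

(* Cell [c] occupies the positions [gap s * c + h] with [h] in the box of side
   [side s]; the remaining positions carry the filler. *)
Definition next_dec (s : stage) (M R l : nat) (f : next_code s M R l) (g : pos) : A :=
  if [forall i, g i %% gap s < side s]%N
  then dec (sval f [ffun i => inord (g i %/ gap s)]) (fun i => g i %% gap s)%N
  else filler.

(** The layer after the last cell is cut off, so a block begins and ends with a cell. *)
Definition next (s : stage) (M R l : nat) : stage :=
  Stage (R.+1 * gap s - spacer s) (~~ spacer s) (@next_dec s M R l).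

Lemma next_decE (s : stage) (M R l : nat) (f : next_code s M R l)
    (c : cell R) (h : pos) : in_box (side s) h ->
  next_dec f (fun i => gap s * c i + h i)%N = dec (sval f c) h.
Proof.
move=> hN; have hg i : (h i < gap s)%N by apply: leq_trans (hN i) (leq_addr _ _).
have dE i : ((gap s * c i + h i) %/ gap s = c i)%N.
  by rewrite mulnC divnMDl ?(leq_ltn_trans _ (hg i))// divn_small ?addn0.
have mE i : ((gap s * c i + h i) %% gap s = h i)%N.
  by rewrite mulnC modnMDl modn_small.
rewrite /next_dec; have -> : [forall i, (gap s * c i + h i) %% gap s < side s]%N.
  by apply/forallP => i; rewrite mE.
congr (dec (sval f _) _).
  by apply/ffunP => i; rewrite ffunE dE inord_val.
by apply/funext => i; rewrite mE.
Qed.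

Lemma card_residue (M R : nat) (t : {ffun 'I_d -> 'I_M.+1}) (b : nat) :
  R.+1 = (b * M.+1)%N -> #|[set c | @residue M R c == t]| = (b ^ d)%N.
Proof.
move=> RE; pose F i : pred 'I_R.+1 := fun j => (j %% M.+1 == t i)%N.
have -> : #|[set c | @residue M R c == t]| = #|(family F : simpl_pred {ffun 'I_d -> 'I_R.+1})|.
  apply: eq_card => c; rewrite !inE; apply/eqP/familyP => [ct i|ct].
    change ((c i %% M.+1)%N == t i).
    by rewrite -ct ffunE inordK// ltn_mod.
  apply/ffunP => i; rewrite ffunE; apply: val_inj => /=; rewrite inordK ?ltn_mod//.
  exact/eqP/(ct i).
rewrite card_family.
have foldE (s : seq 'I_d) : foldr muln 1%N [seq b | _ <- s] = (b ^ size s)%N.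
  by elim: s => //= _ s ->; rewrite expnS.
rewrite -[in RHS](size_enum_ord d) -foldE; congr foldr; apply: eq_map => i.
have lt j : (j * M.+1 + t i < R.+1)%N = (j < b)%N.
  rewrite RE; have := ltn_ord (t i); nia.
rewrite -[RHS]card_ord.
have inj : injective (fun j : 'I_b => inord (j * M.+1 + t i) : 'I_R.+1).
  move=> j j' /(congr1 val) /=; rewrite !inordK ?lt// => /eqP.
  by rewrite eqn_add2r eqn_pmul2r// => /eqP /val_inj.
rewrite -(card_imset _ inj); apply: eq_card => x.
apply/idP/imsetP => [|[j _ ->]].
  change ((x %% M.+1)%N == t i -> exists2 j : 'I_b, j \in 'I_b & x = inord (j * M.+1 + t i)).
  move=> /eqP xt; have xb : (x %/ M.+1 < b)%N by rewrite ltn_divLR// -RE.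
  by exists (Ordinal xb) => //; apply: val_inj; rewrite /= -xt -divn_eq inordK.
change ((inord (j * M.+1 + t i) : 'I_R.+1) %% M.+1 == t i)%N.
by rewrite inordK ?lt// modnMDl modn_small.
Qed.

End stages.

Section tower.
Variables (d : nat) (A : finType) (filler : A) (sel : nat -> stage d A -> nat).
Hypothesis d_gt0 : (0 < d)%N.

(* The number of cells along a side is a multiple of [k.+1`!], which makes the
   gap of level [k.+1] a unit modulo [k.+1`!], hence also of [k`!], which makes the
   residue classes of cells modulo [k`!] equally large. *)
Definition step (k : nat) (s : stage d A) (t : nat) : stage d A :=
  next filler s k`!.-1 (#|code s| * k.+1`! * t).-1
    (#|code s| ^ d.-1 * (k.+1 * t) ^ d)%N.

(** The exponent on the left is the number of cells, so the left side counts all arrangements. The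
    loss is polynomial in [l], with an exponent that does not depend on [t]. *)
Lemma card_code_next (k : nat) (s : stage d A) (t l : nat) :
  (0 < #|code s|)%N -> (0 < t)%N -> l = (#|code s| ^ d.-1 * (k.+1 * t) ^ d)%N ->
  (#|code s| ^ (l * (k`! ^ d * #|code s|)) <=
   l.+1 ^ (#|code s| * (k`! ^ d * #|code s|)) * #|code (step k s t)|)%N.
Proof.
move=> c0 t0 lE.
have cls (r : {ffun 'I_d -> 'I_(k`!.-1).+1}) :
    (#|[set c | @residue d k`!.-1 (#|code s| * k.+1`! * t).-1 c == r]| = #|code s| * l)%N.
  have -> : (#|code s| * l = (#|code s| * k.+1 * t) ^ d)%N.
    by rewrite lE mulnA -expnS prednK// -expnMn mulnA.
  apply: card_residue; rewrite !prednK ?fact_gt0//; first by rewrite factS; lia.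
  by rewrite !muln_gt0 c0 fact_gt0.
have := card_balanced c0 cls.
have -> : #|{: {ffun 'I_d -> 'I_(k`!.-1).+1}}| = (k`! ^ d)%N.
  by rewrite card_ffun !card_ord prednK ?fact_gt0.
rewrite lE => /leq_trans; apply.
rewrite leq_mul2l; apply/orP; right.
by rewrite card_sig leq_eqVlt; apply/orP; left; apply/eqP/eq_card => f; rewrite !inE.
Qed.

Fixpoint st (k : nat) : stage d A :=
  if k is k'.+1 then step k' (st k') (sel k' (st k'))
  else Stage 1 false (fun (a : A) (_ : 'I_d -> nat) => a).

Hypothesis A_gt0 : (0 < #|A|)%N.
Hypothesis sel_ge3 : forall k, (3 <= sel k (st k))%N.

Definition width (k : nat) := (#|code (st k)| * k.+1`! * sel k (st k))%N.
Definition mult (k : nat) := (#|code (st k)| ^ d.-1 * (k.+1 * sel k (st k)) ^ d)%N.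
Local Notation N k := (side (st k)).
Local Notation g k := (gap (st k)).

(** Both sides are the number of cells in one residue class. *)
Lemma mult_blocks k :
  (#|code (st k)| * mult k = (#|code (st k)| * k.+1 * sel k (st k)) ^ d)%N.
Proof. by rewrite /mult mulnA -expnS prednK// -expnMn mulnA. Qed.

(** The counting bound doubles as the existence of a balanced arrangement. *)
Lemma code_gt0 k : (0 < #|code (st k)|)%N.
Proof.
elim: k => // k IH; have t0 : (0 < sel k (st k))%N by exact: leq_trans (sel_ge3 k).
have := @card_code_next k _ _ _ IH t0 erefl.
by case: #|code (step _ _ _)| => //; rewrite muln0 leqn0 expn_eq0 -leqn0 leqNgt IH.
Qed.

Lemma width_ge3 k : (3 <= width k)%N.
Proof.
rewrite /width; have := code_gt0 k; have := fact_gt0 k.+1; have := sel_ge3 k.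
nia.
Qed.

Lemma widthE k : (width k).-1.+1 = width k.
Proof. by rewrite prednK// (leq_trans _ (width_ge3 k)). Qed.

Lemma gap_gt0 k : (0 < g k)%N.
Proof.
rewrite /gap; elim: k => [//|k IH] /=; rewrite -/(width k) widthE /gap.
have := width_ge3 k; move: IH; rewrite /gap.
by case: (spacer (st k)) => /=; nia.
Qed.

Lemma sideS k : (N k.+1 + spacer (st k) = width k * g k)%N.
Proof.
rewrite /= -/(width k) widthE subnK//.
have := width_ge3 k; have := gap_gt0 k.
by case: (spacer (st k)) => /=; nia.
Qed.

Lemma gapS k : (g k.+1 + spacer (st k) = width k * g k + ~~ spacer (st k))%N.
Proof. by rewrite -sideS /gap addnAC. Qed.

Lemma side_gt0 k : (0 < N k)%N.
Proof.
case: k => [//|k]; have := sideS k; have := width_ge3 k; have := gap_gt0 k.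
by case: (spacer (st k)) => /=; nia.
Qed.

Lemma side_ltS k : (N k < N k.+1)%N.
Proof.
have := sideS k; have := width_ge3 k; have := side_gt0 k; rewrite /gap.
by case: (spacer (st k)) => /=; nia.
Qed.

Lemma side_gt k : (k < N k)%N.
Proof. by elim: k => // k IH; apply: leq_trans (side_ltS k). Qed.

Definition code_fun k (f : code (st k.+1)) :
  {ffun cell d (width k).-1 -> code (st k)} := sval f.

Lemma code_funP k (f : code (st k.+1)) :
  balanced (@residue d k`!.-1 (width k).-1) (mult k) (code_fun f).
Proof. exact: svalP f. Qed.

Lemma dec_cell k (f : code (st k.+1)) (c : cell d (width k).-1) h :
  in_box (N k) h ->
  dec f (fun i => g k * c i + h i)%N = dec (code_fun f c) h.
Proof. exact: next_decE. Qed.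

Lemma code_extend k (B : {set cell d (width k).-1}) u :
  (#|B| <= mult k)%N ->
  exists f : code (st k.+1), forall c, c \in B -> code_fun f c = u c.
Proof.
move=> Bl; have /card_gt0P[f0 _] := code_gt0 k.+1.
have [f fb fu] := balanced_extend u (code_funP f0) Bl.
by exists (exist _ f fb).
Qed.

End tower.

(** * Positions of lower blocks inside a block *)

Section rulers.
Variables (d : nat) (A : finType) (filler : A) (sel : nat -> stage d A -> nat).
Hypothesis d_gt0 : (0 < d)%N.
Hypothesis A_gt0 : (0 < #|A|)%N.
Local Notation st := (st filler sel).
Hypothesis sel_ge3 : forall k, (3 <= sel k (st k))%N.
Local Notation width := (width filler sel).
Local Notation mult := (mult filler sel).
Local Notation N k := (side (st k)).
Local Notation g k := (gap (st k)).
Notation pos := ('I_d -> nat).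

Let widthE k : (width k).-1.+1 = width k.
Proof. exact: widthE. Qed.

Let gap_gt0 k : (0 < g k)%N.
Proof. exact: gap_gt0. Qed.

(* [start j n p]: along each coordinate axis, a block of level [n + j] has a
   block of level [j] starting at [p]. Levels are written [n + j] because
   [n.+1 + j] is convertible to [(n + j).+1]. *)
Fixpoint start (j n p : nat) : bool :=
  if n is n'.+1 then
    (p %/ g (n' + j) < width (n' + j))%N && start j n' (p %% g (n' + j))%N
  else p == 0%N.

Lemma start_bound j n p : start j n p -> (p + N j <= N (n + j))%N.
Proof.
elim: n p => [|n IH] p; first by move=> /eqP ->.
move=> /andP[pw /IH] le; have := sideS d_gt0 A_gt0 sel_ge3 (n + j).
rewrite -[(n + j).+1]/(n.+1 + j)%N.
rewrite {1}(divn_eq p (g (n + j))); move: le pw; rewrite /gap.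
set q := (p %/ _)%N; set m := (p %% _)%N; set W := width _.
by case: (spacer (st (n + j))) => /=; nia.
Qed.

(** Since a block begins and ends with blocks of each lower level, layers of filler of different
    levels never touch; the weak inequality [t <= p + N j] absorbs a layer of thickness one. *)
Lemma start_cover j n t : (t <= N (n + j))%N ->
  exists2 p, start j n p & (p <= t <= p + N j)%N.
Proof.
elim: n t => [|n IH] t tN; first by exists 0%N.
have := sideS d_gt0 A_gt0 sel_ge3 (n + j).
rewrite -[(n + j).+1]/(n.+1 + j)%N => sideE.
(* The cap matters only when there is no layer and [t] is the position just past the block. *)
pose c := minn (t %/ g (n + j)) (width (n + j)).-1.
have g0 := gap_gt0 (n + j).
have cg : (c * g (n + j) <= t)%N.
  by apply: leq_trans (leq_trunc_div t (g (n + j))); rewrite leq_mul2r geq_minl orbT.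
have cw : (c < width (n + j))%N by rewrite -(widthE (n + j)) ltnS geq_minr.
have tc : (t - c * g (n + j) <= N (n + j))%N.
  rewrite leq_subLR /c; have [le|lt] := leqP (t %/ g (n + j)) (width (n + j)).-1.
    rewrite {1}(divn_eq t (g (n + j))) leq_add2l -ltnS.
    by rewrite (leq_trans (ltn_pmod _ g0))// /gap; case: spacer; rewrite /=; lia.
  move: tN sideE; rewrite -(widthE (n + j)) /=; rewrite /gap; set w := (width _).-1.
  by case: (spacer (st (n + j))) => /=; nia.
have [p' p's /andP[p't tp']] := IH _ tc.
exists (c * g (n + j) + p')%N; last by apply/andP; split; lia.
have p'g : (p' < g (n + j))%N.
  have := start_bound p's; have := side_gt0 d_gt0 A_gt0 sel_ge3 j.
  by rewrite /gap; lia.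
by rewrite /= divnMDl// divn_small// addn0 cw modnMDl modn_small.
Qed.

Lemma start_separated j n p p' : start j n p -> start j n p' -> (p < p')%N ->
  (p + N j <= p')%N.
Proof.
elim: n p p' => [|n IH] p p'; first by move=> /eqP -> /eqP ->.
move=> /andP[_ ps] /andP[_ p's] pp'.
have pb := start_bound ps.
rewrite (divn_eq p' (g (n + j))) (divn_eq p (g (n + j))).
have [e|e] := eqVneq (p %/ g (n + j))%N (p' %/ g (n + j))%N.
  rewrite e -addnA leq_add2l; apply: IH => //.
  by move: pp'; rewrite {1}(divn_eq p (g (n + j))) {1}(divn_eq p' (g (n + j))) e ltn_add2l.
have lt : (p %/ g (n + j) < p' %/ g (n + j))%N by rewrite ltn_neqAle e leq_div2r// ltnW.
have := leq_mul lt (leqnn (g (n + j))); rewrite mulSn.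
by move: pb; rewrite {2}/gap; lia.
Qed.

Lemma start_dec j n (p : pos) (W : code (st (n + j))) :
  (forall i, start j n (p i)) ->
  exists w : code (st j), forall h, in_box (N j) h ->
    dec W (fun i => p i + h i)%N = dec w h.
Proof.
elim: n p W => [|n IH] p W ps.
  exists W => h _; congr (dec W _); apply/funext => i.
  by rewrite (eqP (ps i)).
pose p' i := (p i %% g (n + j))%N.
have p's i : start j n (p' i) by have /andP[] := ps i.
pose c : cell d (width (n + j)).-1 := [ffun i => inord (p i %/ g (n + j))].
have [w wE] := IH p' (code_fun W c) p's.
exists w => h hN; rewrite -wE// -dec_cell; last first.
  by move=> i; apply: leq_trans (start_bound (p's i)); rewrite ltn_add2l.
congr (dec W _); apply/funext => i; rewrite ffunE inordK; last first.
  by rewrite widthE; have /andP[] := ps i.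
by rewrite addnA /p' [(g _ * _)%N]mulnC -divn_eq.
Qed.

(** [start_cover] finds one start in each of the consecutive intervals of length [(N j).+1]; starts
    in different intervals are distinct, hence begin disjoint blocks. *)
Lemma start_window j n m o : (o + m.+1 * (N j).+1 <= N (n + j))%N ->
  exists q : nat -> nat, forall i, (i < m)%N ->
    [/\ start j n (o + q i), (q i + N j < m.+1 * (N j).+1)%N &
        forall i', (i < i' < m)%N -> (q i + N j <= q i')%N].
Proof.
move=> le.
have H i : exists p, (i < m)%N -> start j n p /\ (o + i * (N j).+1 <= p <= o + i * (N j).+1 + N j)%N.
  have [im|] := ltnP i m; last by exists 0%N.
  have tN : (o + i * (N j).+1 + N j <= N (n + j))%N by nia.
  by have [p ps pb] := start_cover tN; exists p => _; split => //; lia.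
have [p pP] := choice H; exists (fun i => p i - o)%N => i im.
have [ps pb] := pP i im; have op : (o <= p i)%N by lia.
split; [by rewrite subnKC|nia|move=> i' /andP[ii' i'm]].
have [p's p'b] := pP i' i'm.
have := start_separated ps p's; nia.
Qed.

(** At level [k.+1] the gap is -1 modulo the factorial if [spacer (st k)] holds, and the solution is
    [q]; otherwise it is 1 and the solution is [- q], written [q * M.-1]. *)
Lemma residue_unique k q : exists t : 'I_(k`!.-1).+1,
  forall t' : 'I_(k`!.-1).+1, (k`! %| q + g k * t')%N = (t' == t).
Proof.
case: k => [|k].
  exists ord0 => t'; rewrite dvd1n; apply/esym/eqP/val_inj => /=.
  by case: t' => -[].
have f0 := fact_gt0 k.+1; have fE := prednK f0.
have /dvdnP[z zE] : (k.+1`! %| width k * g k)%N.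
  by apply/dvdn_mulr/dvdn_mulr/dvdn_mull.
have gE := gapS d_gt0 A_gt0 sel_ge3 k.
have tlt (t' : 'I_(k.+1`!.-1).+1) : (t' < k.+1`!)%N by rewrite -[ltnRHS]fE.
have modlt x : (x %% k.+1`! < (k.+1`!.-1).+1)%N by rewrite fE ltn_mod.
rewrite zE in gE; set M := k.+1`! in f0 fE gE tlt modlt *.
move: (g k.+1) gE => G gE.
case: (spacer (st k)) gE => /= gE.
  exists (Ordinal (modlt q)) => t'; rewrite -val_eqE /= -[(t' : nat) in RHS](modn_small (tlt t')).
  have -> : (M %| q + G * t')%N = (q + G * t' + t' == t' %[mod M])%N.
    by rewrite eqn_mod_dvd ?leq_addl// addnK.
  have -> : (q + G * t' + t' = z * t' * M + q)%N by nia.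
  by rewrite modnMDl eq_sym.
exists (Ordinal (modlt (q * M.-1)%N)) => t'.
rewrite -val_eqE /= -[(t' : nat) in RHS](modn_small (tlt t')) -(eqn_modDl q).
have -> : (q + q * M.-1 = q * M)%N by nia.
have -> : (q + G * t' = z * t' * M + (q + t'))%N by nia.
by rewrite modnMl /dvdn modnMDl.
Qed.

End rulers.

(** * Occurrences at positions divisible by a factorial *)

Section counting.
Variables (d : nat) (A : finType) (filler : A) (sel : nat -> stage d A -> nat).
Hypothesis d_gt0 : (0 < d)%N.
Hypothesis A_gt0 : (0 < #|A|)%N.
Local Notation st := (st filler sel).
Hypothesis sel_ge3 : forall k, (3 <= sel k (st k))%N.
Local Notation width := (width filler sel).
Local Notation mult := (mult filler sel).
Local Notation N k := (side (st k)).
Local Notation g k := (gap (st k)).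
Notation pos := ('I_d -> nat).

Let widthE k : (width k).-1.+1 = width k.
Proof. exact: widthE. Qed.

(** By [residue_unique] a single class of cells meets the divisibility condition, and balance puts
    every block [mult k] times into that class. *)
Lemma cell_count k (q : pos) (Phi : code (st k) -> bool) (W : code (st k.+1)) :
  (\sum_(c : cell d (width k).-1)
     ([forall i, (k`! %| q i + g k * c i)%N] && Phi (code_fun W c)) =
   mult k * \sum_w Phi w)%N.
Proof.
pose psi w (t : {ffun 'I_d -> 'I_(k`!.-1).+1}) : nat :=
  [forall i, (k`! %| q i + g k * t i)%N] && Phi w.
transitivity (\sum_c psi (code_fun W c) (residue k`!.-1 c))%N.
  apply: eq_bigr => c _; congr (nat_of_bool (_ && _)); apply: eq_forallb => i.
  have -> : residue k`!.-1 c i = (c i %% k`!)%N :> nat.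
    by rewrite ffunE inordK ?ltn_mod// (prednK (fact_gt0 k)).
  move: (nat_of_ord (c i)) => n; rewrite {1}(divn_eq n k`!).
  by rewrite mulnDr addnCA mulnA /dvdn modnMDl.
rewrite (balanced_sum _ (code_funP W)); congr (_ * _)%N; apply: eq_bigr => w _.
have [t tP] := choice (fun i => residue_unique d_gt0 A_gt0 sel_ge3 k (q i)).
rewrite (bigD1 [ffun i => t i])//= big1 ?addn0.
  rewrite /psi; have -> : [forall i, (k`! %| q i + g k * [ffun i => t i] i)%N].
    by apply/forallP => i; rewrite tP ffunE.
  by [].
move=> t' t't; rewrite /psi; apply/eqP; rewrite eqb0 negb_and; apply/orP; left.
apply: contra t't => /forallP t'P; apply/eqP/ffunP => i; rewrite ffunE.
by apply/eqP; rewrite -tP.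
Qed.

Lemma window_count (k m L H r : nat) (q : 'I_d -> nat -> nat)
    (F : pos -> bool) (Phi : code (st k) -> pos -> bool) :
  (H + r <= N k)%N ->
  (forall i j, (j < m)%N -> (q i j + N k.+1 <= L.+1 * k`!)%N) ->
  (forall i j j', (j < j' < m)%N -> (q i j + N k.+1 <= q i j')%N) ->
  (forall j : {ffun 'I_d -> 'I_m}, exists W : code (st k.+1),
     forall (c : cell d (width k).-1) (h : {ffun 'I_d -> 'I_H}),
     F (fun i => q i (j i) + (g k * c i + (h i + r)))%N =
     Phi (code_fun W c) (fun i => h i + r)%N) ->
  (m ^ d * (mult k * \sum_w \sum_(h : {ffun 'I_d -> 'I_H}) Phi w (fun i => h i + r)) <=
   #|[set a : {ffun 'I_d -> 'I_L.+1} | F (fun i => a i * k`!)]|)%N.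
Proof.
move=> HN qL qsep /choice[W WP].
pose C := cell d (width k).-1; pose T := ({ffun 'I_d -> 'I_m} * C * {ffun 'I_d -> 'I_H})%type.
pose P (x : T) : pos := (fun i => q i (x.1.1 i) + (g k * x.1.2 i + (x.2 i + r)))%N.
pose good (x : T) := [forall i, (k`! %| P x i)%N] && Phi (code_fun (W x.1.1) x.1.2) (fun i => x.2 i + r)%N.
pose f (x : T) : {ffun 'I_d -> 'I_L.+1} := [ffun i => inord (P x i %/ k`!)].
have f0 := fact_gt0 k.
have inN (x : T) i : (g k * x.1.2 i + (x.2 i + r) < N k.+1)%N.
  have lt : (x.1.2 i < width k)%N by rewrite (leq_trans (ltn_ord (x.1.2 i)))// widthE.
  have lt2 := ltn_ord (x.2 i); have le := leq_mul lt (leqnn (g k)).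
  have sE := sideS d_gt0 A_gt0 sel_ge3 k; have gE : g k = (N k + spacer (st k))%N by [].
  by move: le; rewrite mulSn -sE mulnC; lia.
have fE x i : good x -> (f x i * k`! = P x i)%N.
  move=> /andP[/forallP/(_ i) dv _]; rewrite ffunE inordK ?divnK//.
  rewrite ltn_divLR// /P (leq_trans _ (qL i (x.1.1 i) (ltn_ord _)))//.
  by rewrite ltn_add2l.
have f_inj : {in good &, injective f}.
  move=> x y gx gy fxy.
  have PE i : P x i = P y i by rewrite -!fE// fxy.
  have jE i : x.1.1 i = y.1.1 i.
    apply: val_inj => /=; have := PE i; rewrite /P.
    have := inN x i; have := inN y i.
    case: (ltngtP (x.1.1 i) (y.1.1 i)) => // lt.
      have := qsep i (x.1.1 i) (y.1.1 i); rewrite lt ltn_ord => /(_ isT); lia.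
    have := qsep i (y.1.1 i) (x.1.1 i); rewrite lt ltn_ord => /(_ isT); lia.
  have hg (z : T) i : (z.2 i + r < g k)%N by have := ltn_ord (z.2 i); rewrite /gap; lia.
  have E i : (g k * x.1.2 i + (x.2 i + r) = g k * y.1.2 i + (y.2 i + r))%N.
    by have := PE i; rewrite /P jE => /addnI.
  have cE i : x.1.2 i = y.1.2 i.
    have := congr1 (fun n => n %/ g k)%N (E i).
    have gk0 : (0 < g k)%N by exact: leq_ltn_trans (hg x i).
    rewrite ![(g k * _)%N]mulnC !divnMDl// !divn_small// !addn0 => e.
    exact: val_inj.
  have hE i : x.2 i = y.2 i.
    apply: val_inj => /=; have := E i; rewrite cE.
    by move=> /addnI/addIn.
  move: jE cE hE; case: x y {gx gy fxy PE E} => [[j c] h] [[j' c'] h'] /= jE cE hE.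
  by congr (_, _, _); apply/ffunP.
have sub : (#|[set x | good x]| <=
    #|[set a : {ffun 'I_d -> 'I_L.+1} | F (fun i => a i * k`!)]|)%N.
  have inj' : {in [set x | good x] &, injective f}.
    by move=> x y; rewrite !inE; exact: f_inj.
  rewrite -(card_in_imset inj'); apply: subset_leq_card.
  apply/fintype.subsetP => _ /imsetP[x gx ->]; move: gx; rewrite !inE => gx.
  have -> : (fun i => f x i * k`!)%N = P x by apply/funext => i; rewrite fE.
  by have := WP x.1.1 x.1.2 x.2; rewrite -/(P x) => ->; case/andP: gx.
apply: leq_trans sub; rewrite -sum1_card [leqRHS]big_mkcond /=.
under [leqRHS]eq_bigr do rewrite inE.
have -> : (\sum_(x : T) (if good x then 1 else 0) =
    \sum_j \sum_h \sum_c (if good (j, c, h) then 1 else 0))%N.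
  under [RHS]eq_bigr do rewrite exchange_big.
  by rewrite !pair_bigA /=; apply: eq_bigr => -[[j c] h].
have E j h : (\sum_(c : C) (if good (j, c, h) then 1 else 0) =
    mult k * \sum_w Phi w (fun i => h i + r))%N.
  pose q' i := (q i (j i) + (h i + r))%N.
  rewrite -(cell_count q' (fun w => Phi w (fun i => h i + r)%N) (W j)).
  apply: eq_bigr => c _.
  have -> : good (j, c, h) = [forall i, (k`! %| q' i + g k * c i)%N] &&
      Phi (code_fun (W j) c) (fun i => h i + r)%N.
    by congr (_ && _); apply: eq_forallb => i; rewrite /P /q' /= [(g k * c i + _)%N]addnC addnA.
  by case: (_ && _).
rewrite [leqRHS](eq_bigr (fun=> mult k * \sum_w \sum_(h : {ffun 'I_d -> 'I_H}) Phi w (fun i => h i + r)))%N.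
  by rewrite sum_nat_const card_ffun !card_ord.
move=> j _; under eq_bigr do rewrite E.
by rewrite -big_distrr /= exchange_big.
Qed.

End counting.

Local Open Scope classical_set_scope.

(** * Subshifts as metric spaces *)

Notation config d A := ('rV[int]_d -> A).

Definition agree (d : nat) (A : Type) (r : nat) (x y : config d A) :=
  forall g : 'rV[int]_d, (forall i, `|g ord0 i| <= r)%N -> x g = y g.

Definition shift_config (d : nat) (A : Type) (g : 'rV[int]_d)
  (x : config d A) : config d A := fun h => x (g + h).

(* [R] is where the distance takes its values; it is a parameter of the type so
   that the metric structure can be inferred. *)
Record subshift (R : realType) (d : nat) (A : Type) (Z : set (config d A))
    (x0 : config d A) (Zx0 : Z x0) :=
  Subshift { point_of :> config d A; point_ofP : Z point_of }.

Section agreement.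
Context {d : nat} {A : Type}.
Implicit Types x y z : config d A.

Lemma agree_sym r x y : agree r x y -> agree r y x.
Proof. by move=> xy g /xy. Qed.

Lemma agree_trans r y x z : agree r x y -> agree r y z -> agree r x z.
Proof. by move=> xy yz g gr; rewrite xy// yz. Qed.

Lemma agree_le r s x y : (r <= s)%N -> agree s x y -> agree r x y.
Proof. by move=> rs xy g gr; apply: xy => i; apply: leq_trans rs. Qed.

Lemma agree_all x y : (forall r, agree r x y) -> x = y.
Proof.
move=> xy; apply/funext => g; apply: (xy (\max_i `|g ord0 i|)%N).
by move=> i; exact: (leq_bigmax (F := fun i => `|g ord0 i|%N)).
Qed.

Lemma agree_shift r (g : 'rV[int]_d) x y :
  agree (r + \max_i `|g ord0 i|)%N x y ->
  agree r (shift_config g x) (shift_config g y).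
Proof.
move=> xy h hr; apply: xy => i; rewrite mxE.
have := hr i; have := leq_bigmax (F := fun i => `|g ord0 i|%N) i.
by rewrite /=; lia.
Qed.

End agreement.

Section subshift_metric.
Context {R : realType} {d : nat} {A : Type} {Z : set (config d A)}.
Context {x0 : config d A} {Zx0 : Z x0}.
Notation X := (subshift R Zx0).
Implicit Types x y z : X.

Lemma subshift_inj x y : point_of x = point_of y -> x = y.
Proof.
case: x y => [x Zx] [y Zy] /= xy; move: xy Zx Zy => -> Zx Zy.
by congr Subshift; exact: Prop_irrelevance.
Qed.

HB.instance Definition _ := gen_eqMixin X.
HB.instance Definition _ := gen_choiceMixin X.
HB.instance Definition _ := isPointed.Build X (Subshift R Zx0 Zx0).

Definition first_invr (p : pred nat) : R :=
  if pselect (exists n, p n) is left ex then (ex_minn ex).+1%:R^-1 else 0.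

Definition sdist x y : R := first_invr (fun n => `[< ~ agree n x y >]).

Lemma sdist_lt n x y : (sdist x y < n.+1%:R^-1) <-> agree n x y.
Proof.
rewrite /sdist /first_invr; case: pselect => [ex|nex]; last first.
  rewrite invr_gt0 ltr0n; split => // _; apply: contrapT => xy.
  by apply: nex; exists n; apply/asboolP.
case: ex_minnP => m /asboolP mxy mmin.
rewrite ltf_pV2 ?posrE ?ltr0n// ltr_nat ltnS; split => [nm|xy].
  apply: contrapT => nxy; have /mmin : `[< ~ agree n x y >] by apply/asboolP.
  by rewrite leqNgt nm.
by rewrite ltnNge; apply/negP => mn; apply: mxy; exact: agree_le xy.
Qed.

Lemma sdistxx x : sdist x x = 0.
Proof.
rewrite /sdist /first_invr; case: pselect => // ex; exfalso.
by case: ex => n /asboolP; apply.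
Qed.

Lemma sdist_eq0 x y : sdist x y = 0 -> x = y.
Proof.
move=> xy; apply: subshift_inj; apply: agree_all => r; apply/sdist_lt.
by rewrite xy invr_gt0 ltr0n.
Qed.

Lemma sdist_sym x y : sdist x y = sdist y x.
Proof.
congr first_invr; apply/funext => n; apply/asbool_equiv_eq.
by split; apply: contra_not => /agree_sym.
Qed.

Lemma sdist_ge0 x y : 0 <= sdist x y.
Proof. by rewrite /sdist /first_invr; case: pselect. Qed.

Lemma sdist_triangle y x z : sdist x z <= sdist x y + sdist y z.
Proof.
rewrite {1}/sdist /first_invr; case: pselect => [ex|_]; last by rewrite addr_ge0// sdist_ge0.
case: ex_minnP => m /asboolP mxz _; apply: contra_notT mxz; rewrite -ltNge => lt.
apply: (agree_trans (y := y)); apply/sdist_lt; apply: le_lt_trans lt.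
  by rewrite lerDl sdist_ge0.
by rewrite lerDr sdist_ge0.
Qed.

HB.instance Definition _ := isMetric.Build R X sdistxx sdist_eq0 sdist_sym
  sdist_triangle.

End subshift_metric.

Section subshift_topology.
Variables (R : realType) (d : nat) (A : finType) (Z : set (config d A)).
Variables (x0 : config d A) (Zx0 : Z x0).
Notation X := (subshift R Zx0).

Lemma mdist_agree n (x y : X) : (mdist x y < n.+1%:R^-1) <-> agree n x y.
Proof. exact: sdist_lt. Qed.

Lemma nbhs_subshiftP (x : X) (U : set X) :
  nbhs x U <-> exists n, forall y : X, agree n x y -> U y.
Proof.
rewrite -nbhs_ballE; split => [[e /= e0 xeU]|[n xnU]].
  have [n ne] : exists n, n.+1%:R^-1 < e.
    exists (Num.truncn e^-1); rewrite invf_plt ?posrE ?ltr0n//.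
    exact: truncnS_gt.
  exists n => y xy; apply: xeU; rewrite ballEmdist/=.
  by apply: lt_trans ne; apply/mdist_agree.
exists n.+1%:R^-1; first by rewrite /= invr_gt0 ltr0n.
by move=> y; rewrite ballEmdist /= => /mdist_agree; exact: xnU.
Qed.

(** Membership is decided on a finite window. Over a finite alphabet these are the finite unions of
    cylinders, an algebra of clopen sets that generates the Borel sets. *)
Definition local_set (U : set X) :=
  exists n, forall x y : X, agree n x y -> U x -> U y.

Lemma local_open U : local_set U -> open U.
Proof.
move=> [n nU]; rewrite openE => x Ux; apply/nbhs_subshiftP.
by exists n => y xy; exact: nU Ux.
Qed.

Lemma local_setT : local_set setT. Proof. by exists 0%N. Qed.

Lemma local_setC U : local_set U -> local_set (~` U).
Proof. by move=> [n nU]; exists n => x y /agree_sym xy nUx /(nU _ _ xy). Qed.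

Lemma local_set0 : local_set set0. Proof. by exists 0%N. Qed.

Lemma local_setU U V : local_set U -> local_set V -> local_set (U `|` V).
Proof.
move=> [n nU] [m mV]; exists (maxn n m) => x y xy [Ux|Vx].
  by left; apply: nU Ux; apply: agree_le xy; rewrite leq_maxl.
by right; apply: mV Vx; apply: agree_le xy; rewrite leq_maxr.
Qed.

Lemma local_setI U V : local_set U -> local_set V -> local_set (U `&` V).
Proof.
by move=> lU lV; rewrite -[U `&` V]setCK setCI; apply: local_setC;
  apply: local_setU; exact: local_setC.
Qed.

Hypothesis Zclosed :
  forall x, (forall n, exists2 z, Z z & agree n x z) -> Z x.


(** An ultrafilter selects one letter of the finite alphabet at each coordinate; these letters form
    its limit point. *)
Lemma ultra_coord (F : set_system X) (FU : UltraFilter F) (g : 'rV[int]_d) :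
  exists a, F [set x : X | x g = a].
Proof.
apply: contrapT => /forallNP Fa.
have /filter_ex [x /(_ (x g))] : F [set x : X | forall a, x g <> a]; last by [].
apply: filter_forall => a.
by have [/Fa|] := in_ultra_setVsetC [set x : X | x g = a] FU.
Qed.

Lemma filter_agree (F : set_system X) (FF : Filter F) (y : config d A) n :
  (forall g, F [set x : X | x g = y g]) -> F [set x : X | agree n y x].
Proof.
move=> Fg.
(* A finite type enumerates the window, so that only finitely many members of the filter are
   intersected. *)
pose cube (f : {ffun 'I_d -> 'I_(n.*2.+1)}) : 'rV[int]_d :=
  \row_i ((f i)%:Z - n%:Z).
have : F [set x : X | forall f, x (cube f) = y (cube f)].
  by apply: filter_forall => f; exact: Fg.
apply: filterS => x xy g gn.
suff [f ->] : exists f, g = cube f by rewrite xy.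
have Hi i : (`|(g ord0 i + n%:Z)%R| < n.*2.+1)%N by have := gn i; lia.
exists [ffun i => Ordinal (Hi i)]; apply/rowP => i; rewrite !mxE ffunE /=.
by have := gn i; rewrite -[g 0 i]/(g ord0 i); lia.
Qed.

Lemma subshift_compact : compact [set: X].
Proof.
rewrite compact_ultra => F FU _.
have [y Fy] := choice (ultra_coord FU).
have Zy : Z y.
  apply: Zclosed => n; have [x yx] := filter_ex (filter_agree _ n Fy).
  by exists x; first exact: point_ofP.
exists (Subshift R Zx0 Zy); split => // U /nbhs_subshiftP [n nU].
by apply: filterS (filter_agree _ n Fy) => x; exact: nU.
Qed.

Hypothesis Zshift : forall g x, Z x -> Z (shift_config g x).

Definition shift_action (g : 'rV[int]_d) (x : X) : X :=
  Subshift R Zx0 (Zshift g (point_ofP x)).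

Lemma shift_actionE g x h : shift_action g x h = x (g + h). Proof. by []. Qed.

Lemma agree_shift_action n (g : 'rV[int]_d) (x y : X) :
  agree (n + \max_i `|g ord0 i|)%N x y ->
  agree n (shift_action g x) (shift_action g y).
Proof. exact: agree_shift. Qed.

Lemma shift_is_action : is_action shift_action.
Proof.
split => [x|g h x|g x].
- by apply: subshift_inj; apply/funext => h /=; rewrite /shift_config add0r.
- apply: subshift_inj; apply/funext => k.
  by rewrite /= /shift_config /= addrA (addrC h).
- move=> U /nbhs_subshiftP[n nU]; apply/nbhs_subshiftP.
  exists (n + \max_i `|g ord0 i|)%N => y xy.
  by apply: nU; exact: agree_shift_action.
Qed.

Lemma local_preimage g U : local_set U -> local_set (shift_action g @^-1` U).
Proof.
move=> [n nU]; exists (n + \max_i `|g ord0 i|)%N => x y xy.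
by apply: nU; exact: agree_shift_action.
Qed.

Lemma shift_dense x (F : set 'rV[int]_d) :
  (forall n (z : X), exists2 g, F g & agree n z (shift_action g x)) ->
  dense [set shift_action f x | f in F].
Proof.
move=> xF U [z Uz] oU; move: oU; rewrite openE => /(_ z Uz).
move=> /nbhs_subshiftP[n nU]; have [g Fg zg] := xF n z.
by exists (shift_action g x); split; [exact: nU|exists g].
Qed.

End subshift_topology.

(** * Frequencies and invariant measures *)

Section averages.
Variables (R : realType) (d : nat) (A : finType) (Z : set (config d A)).
Variables (x0 : config d A) (Zx0 : Z x0).
Hypothesis Zshift : forall g x, Z x -> Z (shift_config g x).
Notation X := (subshift R Zx0).
Notation T := (@shift_action R d A Z x0 Zx0 Zshift).
Local Notation loc := (@local_set R d A Z x0 Zx0).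

Let TD g h x : T (g + h) x = T g (T h x).
Proof. by have [_ ->] := @shift_is_action R d A Z x0 Zx0 Zshift. Qed.

Definition average (E : seq 'rV[int]_d) (f : X -> R) (x : X) : R :=
  (\sum_(e <- E) f (T e x)) / (size E)%:R.

(** Repetitions are kept, so that averaging over [sumset E E'] is exactly the composition of the two
    averaging operators. *)
Definition sumset (E E' : seq 'rV[int]_d) := [seq e + e' | e <- E, e' <- E'].

Lemma size_sumset E E' : size (sumset E E') = (size E * size E')%N.
Proof. exact: size_allpairs. Qed.

Lemma average_sumset E E' f x :
  average (sumset E E') f x = average E' (average E f) x.
Proof.
rewrite /average size_sumset natrM invfM big_allpairs_dep /= mulrA.
congr (_ * _); rewrite exchange_big /= mulr_suml; apply: eq_bigr => e' _.
by congr (_ / _); apply: eq_bigr => e _; rewrite TD.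
Qed.

Lemma average_sumsetC E E' f x : average (sumset E E') f x = average (sumset E' E) f x.
Proof.
rewrite /average !size_sumset mulnC; congr (_ / _).
rewrite !big_allpairs_dep /= exchange_big /=.
by apply: eq_bigr => e' _; apply: eq_bigr => e _; rewrite addrC.
Qed.

Lemma average_le E f g x : (forall y, f y <= g y) -> average E f x <= average E g x.
Proof. by move=> fg; rewrite ler_wpM2r// ler_sum. Qed.

Lemma average_cst E (a : R) x : (0 < size E)%N -> average E (cst a) x = a.
Proof.
move=> E0; rewrite /average /= big_const_seq count_predT iter_addr.
by rewrite addr0 -[X in X / _]mulr_natr mulfK// pnatr_eq0 -lt0n.
Qed.

Lemma averageD E f g x : average E (f \+ g) x = average E f x + average E g x.
Proof. by rewrite /average big_split /= mulrDl. Qed.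

Lemma average_indic_ge0 E U x : 0 <= average E \1_U x.
Proof. by rewrite divr_ge0// sumr_ge0// => e _; rewrite indicE. Qed.

Lemma average_indic_le1 E U x : (0 < size E)%N -> average E \1_U x <= 1.
Proof.
move=> E0; rewrite -(average_cst 1 x E0); apply: average_le => y.
by rewrite indicE /cst /= lern1; case: (_ \in _).
Qed.

(** The frequency is the best uniform lower bound of averages over finite lists, which is defined
    for every set and needs no limit along a chosen sequence. *)
Definition lower_averages (U : set X) : set R :=
  [set a | exists2 E, (0 < size E)%N & forall x, a <= average E \1_U x].

Definition frequency (U : set X) : R := sup (lower_averages U).

(** A lower bound along [E'] and an upper bound along [E] both persist along the sumset, because the
    two averages commute. *)
Lemma lower_averages_le U a E b : (0 < size E)%N ->
  (forall x, average E \1_U x <= b) -> lower_averages U a -> a <= b.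
Proof.
move=> E0 Eb [E' E'0 aE']; pose x : X := Subshift R Zx0 Zx0.
rewrite -(average_cst a x E0) -(average_cst b x E'0).
apply: (@le_trans _ _ (average (sumset E' E) \1_U x)).
  by rewrite average_sumset; exact: average_le.
by rewrite average_sumsetC average_sumset; exact: average_le.
Qed.

Lemma lower_averages_has_sup U : has_sup (lower_averages U).
Proof.
split; first by exists 0, [:: 0] => // x; exact: average_indic_ge0.
exists 1 => a; apply: (@lower_averages_le _ _ [:: 0]) => // x.
exact: average_indic_le1.
Qed.

Lemma frequency_ge U E a : (0 < size E)%N ->
  (forall x, a <= average E \1_U x) -> a <= frequency U.
Proof.
move=> E0 aE; apply: ub_le_sup; first by case: (lower_averages_has_sup U).
by exists E.
Qed.

Lemma frequency_le U E b : (0 < size E)%N ->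
  (forall x, average E \1_U x <= b) -> frequency U <= b.
Proof.
move=> E0 Eb; apply: ge_sup; first by case: (lower_averages_has_sup U).
by move=> a; exact: (lower_averages_le E0 Eb).
Qed.

Lemma frequency_ge0 U : 0 <= frequency U.
Proof. exact: (@frequency_ge _ [:: 0] 0 isT (average_indic_ge0 _ _)). Qed.

Lemma frequency_setT : frequency setT = 1.
Proof.
apply/eqP; rewrite eq_le; apply/andP; split.
  by apply: (@frequency_le _ [:: 0]) => // x; exact: average_indic_le1.
by apply: (@frequency_ge _ [:: 0]) => // x; rewrite indicT average_cst.
Qed.

Lemma frequency_preimage g U : frequency (T g @^-1` U) = frequency U.
Proof.
have TE h E x : average E \1_(T h @^-1` U) x = average E \1_U (T h x).
  rewrite /average; congr (_ / _); apply: eq_bigr => e _.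
  by rewrite -TD addrC TD !indicE; congr (_%:R); congr (nat_of_bool _);
    apply/idP/idP; rewrite !inE.
congr sup; apply/seteqP; split => a [E E0 aE]; exists E => // x.
  rewrite (_ : x = T g (T (- g) x)) -?TE//.
  rewrite -TD subrr.
  by have [->] := @shift_is_action R d A Z x0 Zx0 Zshift.
by rewrite TE.
Qed.

Definition equidistributed_on (F : set 'rV[int]_d) (U : set X) :=
  forall eps : R, 0 < eps -> exists E c,
    [/\ (0 < size E)%N, forall e, e \in E -> F e &
        forall x, `|average E \1_U x - c| <= eps].

(** [frequency] involves lists in the whole group, so the constants belonging to all [eps] and all
    [F] are pinned to one value. Hence a single measure serves all the subgroups. *)
Lemma equidistributed_frequency F U : equidistributed_on F U ->
  forall eps : R, 0 < eps -> exists E,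
    [/\ (0 < size E)%N, forall e, e \in E -> F e &
        forall x, `|average E \1_U x - frequency U| <= eps].
Proof.
move=> FU eps eps0; have eps20 : 0 < eps / 2 by rewrite divr_gt0.
have [E [c [E0 EF Ec]]] := FU _ eps20.
exists E; split => // x.
have le : frequency U <= c + eps / 2.
  by apply: (frequency_le E0) => y; have := Ec y; rewrite ler_norml; lra.
have ge : c - eps / 2 <= frequency U.
  by apply: (frequency_ge E0) => y; have := Ec y; rewrite ler_norml; lra.
by have := Ec x; rewrite !ler_norml; lra.
Qed.

(** The sumset of a good list for [U] and a good list for [V] is good for both sets at once. *)
Lemma frequencyD U V : equidistributed_on setT U -> equidistributed_on setT V ->
  U `&` V = set0 -> frequency (U `|` V) = frequency U + frequency V.
Proof.
move=> /equidistributed_frequency eU /equidistributed_frequency eV UV0.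
apply/eqP; rewrite -subr_eq0 -normr_le0; apply/ler_addgt0Pl => e e0; rewrite addr0.
have e20 : 0 < e / 2 by rewrite divr_gt0.
have [E [E0 _ EU]] := eU _ e20; have [E' [E'0 _ EV]] := eV _ e20.
have EE0 : (0 < size (sumset E E'))%N by rewrite size_sumset muln_gt0 E0.
have HU y : `|average (sumset E E') \1_U y - frequency U| <= e / 2.
  have l z : frequency U - e / 2 <= average E \1_U z <= frequency U + e / 2.
    by have := EU z; rewrite ler_norml; lra.
  rewrite average_sumset.
  have h1 : frequency U - e / 2 <= average E' (average E \1_U) y.
    rewrite -[leLHS](average_cst _ y E'0); apply: average_le => z.
    by case/andP: (l z).
  have h2 : average E' (average E \1_U) y <= frequency U + e / 2.
    rewrite -[leRHS](average_cst _ y E'0); apply: average_le => z.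
    by case/andP: (l z).
  by rewrite ler_norml; lra.
have HV y : `|average (sumset E E') \1_V y - frequency V| <= e / 2.
  have l z : frequency V - e / 2 <= average E' \1_V z <= frequency V + e / 2.
    by have := EV z; rewrite ler_norml; lra.
  rewrite average_sumsetC average_sumset.
  have h1 : frequency V - e / 2 <= average E (average E' \1_V) y.
    rewrite -[leLHS](average_cst _ y E0); apply: average_le => z.
    by case/andP: (l z).
  have h2 : average E (average E' \1_V) y <= frequency V + e / 2.
    rewrite -[leRHS](average_cst _ y E0); apply: average_le => z.
    by case/andP: (l z).
  by rewrite ler_norml; lra.
have HE y : average (sumset E E') \1_(U `|` V) y =
    average (sumset E E') \1_U y + average (sumset E E') \1_V y.
  rewrite -averageD; congr average; apply/funext => z /=.
  rewrite !indicE -natrD; congr (_%:R).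
  have [zU|zU] := boolP (z \in U); have [zV|zV] := boolP (z \in V).
  - by have : (U `&` V) z; [split; exact/set_mem|rewrite UV0].
  - by rewrite mem_set//; left; exact/set_mem.
  - by rewrite mem_set//; right; exact/set_mem.
  - by rewrite memNset// => -[/mem_set|/mem_set]; exact/negP.
have le : frequency (U `|` V) <= frequency U + frequency V + e.
  apply: (frequency_le EE0) => y.
  by rewrite HE; have := HU y; have := HV y; rewrite !ler_norml; lra.
have ge : frequency U + frequency V - e <= frequency (U `|` V).
  apply: (frequency_ge EE0) => y.
  by rewrite HE; have := HU y; have := HV y; rewrite !ler_norml; lra.
by rewrite ler_norml; lra.
Qed.

End averages.

(** * A probability measure from a content on clopen sets *)

Definition algebra_type (T : Type) (G : set (set T)) (G0 : G set0)
  (GU : setU_closed G) (GC : setC_closed G) : Type := T.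

Section algebra_type.
Variables (T : pointedType) (G : set (set T)).
Hypotheses (G0 : G set0) (GU : setU_closed G) (GC : setC_closed G).
HB.instance Definition _ := Pointed.on (algebra_type G0 GU GC).
HB.instance Definition _ := @isAlgebraOfSets.Build default_measure_display
  (algebra_type G0 GU GC) G G0 GU GC.
End algebra_type.

Section clopen_content.
Variables (R : realType) (X : pmetricType R) (G : set (set X)) (c : set X -> R).
Hypotheses (G0 : G set0) (GU : setU_closed G) (GC : setC_closed G).
Hypothesis Gopen : G `<=` @open X.
Hypothesis Gborel : @open X `<=` <<s G >>.
Hypothesis Xcompact : compact [set: X].
Hypotheses (c_ge0 : forall U, 0 <= c U) (c_setT : c setT = 1).
Hypothesis c_setU :
  forall U V, G U -> G V -> U `&` V = set0 -> c (U `|` V) = c U + c V.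

Let gX := algebra_type G0 GU GC.

Definition clopen_content (U : set gX) : \bar R := (c U)%:E.

Let c_set0 : c set0 = 0.
Proof.
have := c_setU G0 G0 (set0I _); rewrite setU0 => /eqP.
by rewrite -subr_eq0 opprD addNKr oppr_eq0 => /eqP.
Qed.

Let content_ge0 (U : set gX) : (0 <= clopen_content U)%E.
Proof. by rewrite lee_fin. Qed.

Let content_semi_additive : measure_function.semi_additive clopen_content.
Proof.
apply/measure_function.additive2P; first by rewrite /clopen_content c_set0.
by move=> U V mU mV UV; rewrite /clopen_content c_setU// EFinD.
Qed.

HB.instance Definition _ := isContent.Build _ gX R clopen_content
  content_ge0 content_semi_additive.

(** A countable cover of a clopen set by clopen sets has a finite subcover, so countable
    subadditivity reduces to the finite one. *)
Let content_sigma_subadditive :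
  measurable_subset_sigma_subadditive clopen_content.
Proof.
move=> U F mF mU UF.
have cptU : compact (U : set X).
  apply: (subclosed_compact _ Xcompact) => //.
  rewrite -[U in closed U]setCK; apply: open_closedC; apply: Gopen; exact: GC.
move: cptU; rewrite compact_cover => /(_ _ setT F).
case=> [i _|//|D _ UD]; first exact: Gopen (mF i).
pose N := (\max_(i <- D) i).+1.
apply: (@le_trans _ _ (\sum_(k < N) clopen_content (F k))).
  apply: (@content_subadditive _ R gX clopen_content) => //.
  move=> x /UD [i /= iD Fix]; rewrite -bigcup_mkord; exists i => //=.
  by rewrite ltnS; apply: (leq_bigmax_seq (F := id)).
rewrite -(big_mkord xpredT (fun k => clopen_content (F k))).
exact: nneseries_lim_ge.
Qed.

HB.instance Definition _ := Content_SigmaSubAdditive_isMeasure.Build _ R gX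
  clopen_content content_sigma_subadditive.

Let sX := g_sigma_algebraType (@measurable _ gX).


Let borel_measurable (U : set X) :
  @measurable _ (borel X) U -> @measurable _ sX U.
Proof.
have : <<s @open X >> `<=` <<s G >>.
  by apply: smallest_sub; [exact: smallest_sigma_algebra|exact: Gborel].
exact.
Qed.

Definition clopen_measure (U : set (borel X)) : \bar R :=
  measure_extension clopen_content (U : set sX).

Let clopen_measure0 : clopen_measure set0 = 0%E.
Proof. exact: measure0. Qed.

Let clopen_measure_ge0 (U : set (borel X)) : (0 <= clopen_measure U)%E.
Proof. exact: measure_ge0. Qed.

Let clopen_measure_sigma_additive : semi_sigma_additive clopen_measure.
Proof.
move=> F mF tF mUF.
by apply: (@measure_semi_sigma_additive _ sX R (measure_extension clopen_content));
  [move=> i; exact: borel_measurable|exact: tF|exact: borel_measurable].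
Qed.

HB.instance Definition _ := isMeasure.Build _ (borel X) R clopen_measure
  clopen_measure0 clopen_measure_ge0 clopen_measure_sigma_additive.

Let clopen_measureE U : G U -> clopen_measure U = (c U)%:E.
Proof. by move=> GU'; rewrite /clopen_measure /measure_extension measurable_mu_extE. Qed.

Let clopen_measure_setT : clopen_measure setT = 1%E.
Proof.
rewrite clopen_measureE ?c_setT// -setC0; exact: GC.
Qed.

HB.instance Definition _ := Measure_isProbability.Build _ (borel X) R
  clopen_measure clopen_measure_setT.

Lemma clopen_content_extension :
  exists mu : probability (borel X) R, forall U, G U -> mu U = (c U)%:E.
Proof. by exists clopen_measure; exact: clopen_measureE. Qed.

End clopen_content.

Lemma borel_probability_unique (R : realType) (X : pmetricType R)
    (G : set (set X)) (mu nu : probability (borel X) R) :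
  G setT -> setI_closed G -> G `<=` @open X -> @open X `<=` <<s G >> ->
  (forall U, G U -> mu U = nu U) ->
  forall U : set (borel X), measurable U -> mu U = nu U.
Proof.
move=> GT GI Go oG munu U mU.
apply: (@g_sigma_algebra_measure_unique _ R (borel X) G _ (fun=> setT)) => //.
- by move=> V /Go oV; exact: sub_sigma_algebra.
- by rewrite bigcup_const.
- by move=> _; rewrite [X in (X < _)%E](_ : _ = 1%E) ?ltry//; exact: (probability_setT mu).
- have : <<s @open X >> `<=` <<s G >>.
    by apply: smallest_sub; [exact: smallest_sigma_algebra|exact: oG].
  exact.
Qed.

(** * Subgroups of finite index *)

Definition multiples (d m : nat) : set 'rV[int]_d :=
  [set g | exists h, g = h *+ m].

(** Pigeonhole on cosets puts a positive multiple of each basis vector in [F]; [m] is the product of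
    the multipliers. Equidistribution is thus needed along [multiples m] only. *)
Lemma finite_index_multiples (d : nat) (F : set 'rV[int]_d) :
  is_subgroup F -> finite_index F ->
  exists2 m, (0 < m)%N & multiples m `<=` F.
Proof.
move=> [F0 FB] Ffin.
have FN g : F g -> F (- g) by move=> Fg; rewrite -[- g]add0r; exact: FB.
have FD g h : F g -> F h -> F (g + h).
  by move=> Fg Fh; rewrite -[h]opprK; apply: FB => //; exact: FN.
have FM g n : F g -> F (g *+ n).
  by move=> Fg; elim: n => [|n IH]; rewrite ?mulr0n ?mulrSr//; exact: FD.
have period (g : 'rV[int]_d) : exists n, F (g *+ n.+1).
  pose coset (j : nat) := [set g *+ j + f | f in F].
  have : ~ injective coset.
    move=> inj; apply: infinite_nat.
    have : finite_set (range coset).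
      by apply: sub_finite_set Ffin => _ [j _ <-]; exists (g *+ j).
    rewrite (eq_finite_set (inj_card_eq _))// => ? ? _ _; exact: inj.
  move=> /existsNP[i /existsNP[j /not_implyP[cij /eqP ij]]].
  wlog lt : i j cij ij / (i < j)%N.
    move=> H; have [lt|] := ltnP i j; first exact: (H i j).
    rewrite leq_eqVlt eq_sym (negbTE ij) /= => lt.
    by apply: (H j i) => //; rewrite eq_sym.
  have : coset j (g *+ j) by exists 0; rewrite ?addr0.
  rewrite -cij => -[f Ff fE]; exists (j - i).-1.
  by rewrite prednK ?subn_gt0// mulrnBr ?(ltnW lt)// -fE addrC addKr.
have [n nF] := choice (fun i : 'I_d => period (delta_mx 0 i)).
exists (\prod_i (n i).+1)%N; first by rewrite prodn_gt0.
move=> _ [h ->].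
rewrite [h]row_sum_delta -sumrMnl; apply: (big_ind F) => // i _.
rewrite (bigD1 i)//= mulrnA -[h 0 i]intz scaler_int.
suff FZ k : F ((delta_mx 0 i *~ k) *+ (n i).+1) by exact: FM.
case: k => k; first by rewrite -pmulrn -mulrnA mulnC mulrnA; exact: FM.
by rewrite NegzE mulrNz mulNrn -pmulrn -mulrnA mulnC mulrnA; apply/FN/FM.
Qed.

Section uniquely_ergodic.
Variables (R : realType) (d : nat) (A : finType) (Z : set (config d A)).
Variables (x0 : config d A) (Zx0 : Z x0).
Hypothesis Zclosed :
  forall x, (forall n, exists2 z, Z z & agree n x z) -> Z x.
Hypothesis Zshift : forall g x, Z x -> Z (shift_config g x).
Notation X := (subshift R Zx0).
Notation T := (@shift_action R d A Z x0 Zx0 Zshift).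
Notation loc := (@local_set R d A Z x0 Zx0).
Notation avg := (average Zshift).
Notation freq := (frequency Zshift).
Hypothesis equi : forall m U, (0 < m)%N -> loc U ->
  equidistributed_on Zshift (@multiples d m) U.

Let locU : setU_closed loc. Proof. by move=> U V; exact: local_setU. Qed.
Let locC : setC_closed loc. Proof. by move=> U; exact: local_setC. Qed.
Let locI : setI_closed loc. Proof. by move=> U V; exact: local_setI. Qed.

Let open_local : @open X `<=` <<s loc >>.
Proof.
move=> U oU; pose V n := [set x : X | forall y : X, agree n x y -> U y].
have lV n : loc (V n).
  exists n => x y xy Vx z yz; apply: Vx; exact: agree_trans yz.
have -> : U = \bigcup_n V n.
  apply/seteqP; split => x; last by move=> [n _]; exact.
  by move: oU; rewrite openE => /[apply] /nbhs_subshiftP[n nU]; exists n.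
by apply: sigma_algebra_bigcup => n; exact: sub_gen_smallest.
Qed.

Let measurable_local U : loc U -> @measurable _ (borel X) U.
Proof. by move=> lU; apply: sub_gen_smallest; exact: local_open. Qed.

(** The integral of an average along [E] against a measure invariant under [E] is the measure of
    [U]. *)
Lemma measure_le_average (F : set 'rV[int]_d) (nu : probability (borel X) R)
    (U : set X) E b : invariant_measure T F nu -> loc U -> (0 < size E)%N ->
  (forall e, e \in E -> F e) -> (forall x, avg E \1_U x <= b) ->
  (nu U <= b%:E)%E.
Proof.
move=> nuF lU E0 EF Eb.
have sE0 : 0 < (size E)%:R :> R by rewrite ltr0n.
have b0 : 0 <= b.
  by apply: le_trans (Eb point); rewrite divr_ge0// sumr_ge0// => e _; rewrite indicE.
have mT e : @measurable _ (borel X) (T e @^-1` U).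
  by apply: measurable_local; exact: local_preimage.
have iE : (\int[nu]_x (\sum_(e <- E) (\1_(T e @^-1` U) x)%:E) =
           (size E)%:R%:E * nu U)%E.
  have mI e : measurable_fun [set: borel X] (fun x : borel X =>
      (\1_(T e @^-1` U : set X) (x : X) : R)%:E).
    by apply/measurable_EFinP; exact: measurable_indic.
  have I0 e (x : borel X) : [set: borel X] x ->
      (0 <= (\1_(T e @^-1` U : set X) (x : X) : R)%:E)%E.
    by move=> _; rewrite lee_fin indicE.
  rewrite (ge0_integral_sum nu measurableT mI I0).
  rewrite (eq_big_seq (fun=> nu U)) => [|e eE].
    by rewrite big_const_seq count_predT iter_addr addr0 mule_natl.
  rewrite integral_indic//; first by rewrite setIT; apply: nuF (EF _ eE) _; exact: measurable_local.
have : ((size E)%:R%:E * nu U <= (size E)%:R%:E * b%:E)%E.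
  rewrite -iE; apply: (@le_trans _ _ (\int[nu]_x (cst ((size E)%:R * b)%:E x))%E).
    apply: ge0_le_integral => //.
    - by move=> x _; apply: sume_ge0 => e _; rewrite lee_fin indicE.
    - apply: emeasurable_sum => e; apply/measurable_EFinP.
      exact: measurable_indic.
    - by move=> x _; rewrite sumEFin lee_fin mulrC -ler_pdivrMr//; exact: Eb.
  by rewrite integral_cst// [X in (_ * X)%E](_ : _ = 1%E) ?mule1 ?EFinM//;
    exact: (probability_setT nu).
by rewrite lee_pmul2l// lte_fin.
Qed.

Lemma average_indicC E (U : set X) x : (0 < size E)%N ->
  avg E \1_(~` U) x = 1 - avg E \1_U x.
Proof.
move=> E0; rewrite -(average_cst Zshift 1 x E0) (_ : cst 1 = \1_U \+ \1_(~` U)).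
  by rewrite averageD addrC addKr.
apply/funext => y /=; rewrite !indicE in_setC.
by case: (_ \in _); rewrite /= ?addr0 ?add0r.
Qed.

(** The bound [measure_le_average] for the complement of [U] is the missing lower bound for [U]. *)
Lemma invariant_local (F : set 'rV[int]_d) (nu : probability (borel X) R) m U :
  (0 < m)%N -> multiples m `<=` F -> invariant_measure T F nu -> loc U ->
  nu U = (freq U)%:E.
Proof.
move=> m0 mF nuF lU.
have mU := measurable_local lU.
have nufin : nu U \is a fin_num by exact: fin_num_measure.
rewrite -(fineK nufin); congr (_%:E).
apply/eqP; rewrite -subr_eq0 -normr_le0; apply/ler_addgt0Pl => e e0; rewrite addr0.
have [E [E0 EF Efreq]] := equidistributed_frequency (equi m0 lU) e0.
have EF' e' : e' \in E -> F e' by move=> /EF/mF.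
have h1 : (nu U <= (freq U + e)%:E)%E.
  apply: (measure_le_average nuF lU E0 EF') => x.
  by have := Efreq x; rewrite ler_norml; lra.
have h2 : (nu (~` U) <= (1 - freq U + e)%:E)%E.
  apply: (measure_le_average nuF (local_setC lU) E0 EF') => x.
  by rewrite average_indicC//; have := Efreq x; rewrite ler_norml; lra.
move: h2; rewrite (@probability_setC _ _ R nu)//.
move: h1; rewrite -(fineK nufin) -EFinB !lee_fin => h1 h2.
by rewrite ler_norml; lra.
Qed.

Theorem equidistributed_uniquely_ergodic :
  exists2 mu : probability (borel X) R, unique_invariant T setT mu &
    forall F, is_subgroup F -> finite_index F -> uniquely_ergodic T F.
Proof.
have equiT U : loc U -> equidistributed_on Zshift setT U.
  move=> lU e e0; have [E [c [E0 _ Ec]]] := equi (ltn0Sn 0) lU e0.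
  by exists E, c.
have [|||||mu muE] := @clopen_content_extension R X loc freq
    (@local_set0 _ _ _ _ _ _) locU locC _ open_local.
- by move=> U; exact: local_open.
- exact: subshift_compact.
- exact: frequency_ge0.
- exact: frequency_setT.
- by move=> U V lU lV; apply: frequencyD; exact: equiT.
have eq_mu (nu : probability (borel X) R) :
    (forall U, loc U -> nu U = (freq U)%:E) ->
    forall U : set (borel X), measurable U -> nu U = mu U.
  move=> nuE; apply: (@borel_probability_unique R X loc) => //.
  - exact: local_setT.
  - by move=> U; exact: local_open.
  - by move=> U lU; rewrite nuE// muE.
have mT g (U : set (borel X)) : measurable U -> @measurable _ (borel X) (T g @^-1` U).
  move=> mU; have : measurable_fun [set: borel X] (T g : borel X -> borel X).
    apply: (@measurability _ _ (borel X) (borel X) _ _ (@open X)) => //.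
    move=> _ [V oV <-]; rewrite setTI; apply: sub_gen_smallest.
    by apply: open_comp => // x _; have [_ _] := @shift_is_action R d A Z x0 Zx0 Zshift; exact.
  by move=> /(_ measurableT _ mU); rewrite setTI.
have mu_inv : invariant_measure T setT mu.
  move=> g U _ mU.
  have mTg : measurable_fun [set: borel X] (T g : borel X -> borel X).
    by move=> _ V mV; rewrite setTI; exact: mT.
  (* The image of [mu] under [T g] has the same values on local sets, hence is [mu]. *)
  pose nu := distribution mu (mfun_Sub (mem_set mTg)).
  apply: (eq_mu nu) => // V lV.
  by rewrite -(frequency_preimage Zshift g V) -muE//; exact: local_preimage.
exists mu.
  split => // nu nuT; apply: eq_mu => U lU.
  by apply: (@invariant_local setT _ 1%N).
move=> F sF /(finite_index_multiples sF)[m m0 mF]; exists mu; split.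
  by move=> g U _ mU; exact: mu_inv.
by move=> nu nuF; apply: eq_mu => U lU; exact: (invariant_local m0 mF nuF lU).
Qed.

End uniquely_ergodic.

(** * The subshift of a tower *)

Section language.
Variables (d : nat) (A : finType) (filler : A) (sel : nat -> stage d A -> nat).
Hypothesis d_gt0 : (0 < d)%N.
Hypothesis A_gt0 : (0 < #|A|)%N.
Local Notation st := (st filler sel).
Hypothesis sel_ge3 : forall k, (3 <= sel k (st k))%N.
Local Notation width := (width filler sel).
Local Notation mult := (mult filler sel).
Local Notation N k := (side (st k)).
Local Notation g k := (gap (st k)).
Notation pos := ('I_d -> nat).

(** [absz] merely converts to naturals: the sums are nonnegative wherever the value is used. *)
Definition at_pos (o : pos) (h : 'rV[int]_d) : pos := fun i => absz ((o i)%:Z + h ord0 i)%R.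

(* Asking for [r <= K] costs nothing, a block of level [K] being part of blocks
   of all higher levels, and makes the levels available. *)
Definition tower_language : set (config d A) :=
  [set x | forall r, exists K, (r <= K)%N /\ exists (W : code (st K)) (o : pos),
    (forall i, (r <= o i)%N /\ (o i + r < N K)%N) /\
    forall h : 'rV[int]_d, (forall i, `|h ord0 i| <= r)%N -> x h = dec W (at_pos o h)].

Lemma tower_language_closed x :
  (forall n, exists2 z, tower_language z & agree n x z) -> tower_language x.
Proof.
move=> xz r; have [z /(_ r)[K [rK [W [u [uN zE]]]]] xzr] := xz r.
by exists K; split => //; exists W, u; split => // h hr; rewrite xzr// zE.
Qed.

Lemma tower_language_shift (v : 'rV[int]_d) x :
  tower_language x -> tower_language (shift_config v x).
Proof.
clear d_gt0 A_gt0; move=> xL r.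
have [m vm] : exists m, forall i, (`|v ord0 i| <= m)%N.
  exists (\max_i `|v ord0 i|)%N => i.
  exact: (leq_bigmax (F := fun i => `|v ord0 i|%N)).
have [K [rK [W [u [uN xE]]]]] := xL (r + m)%N.
exists K; split; first by apply: leq_trans rK; rewrite leq_addr.
exists W, (at_pos u v); split.
  by move=> i; rewrite /at_pos; have [] := uN i; have := vm i; lia.
move=> h hr; rewrite /shift_config xE; last first.
  by move=> i; rewrite mxE /=; have := hr i; have := vm i; lia.
congr (dec W _); apply/funext => i; rewrite /at_pos mxE /=.
by have [] := uN i; have := vm i; lia.
Qed.

Section chain.
Variables (k0 : nat) (W : forall n, code (st (n + k0))).
Hypothesis W_ext : forall n, code_fun (W n.+1) [ffun=> inord 1] = W n.

(** [W n] is placed with its corner at [- origin n] on every axis. Cell 1 is neither first nor last,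
    so the boxes grow in all directions and exhaust the group. *)
Fixpoint origin n : nat := if n is n'.+1 then g (n' + k0) + origin n' else 0.

Let box n (h : 'rV[int]_d) := forall i,
  (0 <= (origin n)%:Z + h ord0 i) && ((origin n)%:Z + h ord0 i < (N (n + k0))%:Z).

Let width_ge3 k : (3 <= width k)%N. Proof. exact: width_ge3. Qed.
Let gap_gt0 k : (0 < g k)%N. Proof. exact: gap_gt0. Qed.
Let sideS k : (N k.+1 + spacer (st k) = width k * g k)%N. Proof. exact: sideS. Qed.

Lemma origin_ge n : (n <= origin n)%N.
Proof. by elim: n => //= n IH; have := gap_gt0 (n + k0); lia. Qed.

Lemma origin_lt n : (origin n + n < N (n + k0))%N.
Proof.
elim: n => [|n IH]; first by rewrite addn0; exact: side_gt0.
rewrite -[(n.+1 + k0)%N]/(n + k0).+1 -[origin n.+1]/(g (n + k0) + origin n)%N.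
have sE := sideS (n + k0); have gE : g (n + k0) = (N (n + k0) + spacer (st (n + k0)))%N by [].
have := leq_mul (width_ge3 (n + k0)) (leqnn (g (n + k0))).
by have := gap_gt0 (n + k0); lia.
Qed.

Let boxS n h : box n h -> box n.+1 h /\
  dec (W n.+1) (at_pos (fun=> origin n.+1) h) = dec (W n) (at_pos (fun=> origin n) h).
Proof.
move=> hb; have W3 := width_ge3 (n + k0).
have sE := sideS (n + k0); have gE : g (n + k0) = (N (n + k0) + spacer (st (n + k0)))%N by [].
have le := leq_mul W3 (leqnn (g (n + k0))).
split.
  move=> i; have := hb i; rewrite -[(n.+1 + k0)%N]/(n + k0).+1.
  rewrite -[origin n.+1]/(g (n + k0) + origin n)%N.
  by case/andP => b1 b2; apply/andP; split; lia.
rewrite -(W_ext n) -dec_cell; last by move=> i; rewrite /at_pos; have := hb i; lia.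
congr (dec (W n.+1) _); apply/funext => i; rewrite ffunE inordK; last by rewrite widthE//; lia.
rewrite /at_pos muln1 -[origin n.+1]/(g (n + k0) + origin n)%N.
by have := hb i; lia.
Qed.

Let box_le n m h : (n <= m)%N -> box n h -> box m h /\
  dec (W m) (at_pos (fun=> origin m) h) = dec (W n) (at_pos (fun=> origin n) h).
Proof.
move=> /subnK <-; elim: (m - n)%N => [//|p IH] hb.
have [hb' E] := IH hb; have [hb'' E'] := boxS hb'.
by split=> //; rewrite -E -E'.
Qed.

Lemma chain_point : exists2 x : config d A, tower_language x &
  forall n (h : 'rV[int]_d),
    (forall i, (0 <= (origin n)%:Z + h ord0 i) && ((origin n)%:Z + h ord0 i < (N (n + k0))%:Z)) ->
    x h = dec (W n) (at_pos (fun=> origin n) h).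
Proof.
have box_norm n (h : 'rV[int]_d) : (forall i, `|h ord0 i| <= n)%N -> box n h.
  move=> hn i; have := hn i; have := origin_ge n; have := origin_lt n.
  by move=> *; apply/andP; split; lia.
pose m (h : 'rV[int]_d) := (\max_i `|h ord0 i|)%N.
have bm h : box (m h) h.
  by apply: box_norm => i; exact: (leq_bigmax (F := fun i => `|h ord0 i|%N)).
pose x h := dec (W (m h)) (at_pos (fun=> origin (m h)) h).
have xE n h : box n h -> x h = dec (W n) (at_pos (fun=> origin n) h).
  move=> hn; rewrite /x.
  have [_ <-] := box_le (leq_maxl (m h) n) (bm h).
  by have [_ <-] := box_le (leq_maxr (m h) n) hn.
exists x => // r; exists (r + k0)%N; split; first exact: leq_addr.
exists (W r), (fun=> origin r); split.
  by move=> i; rewrite origin_ge origin_lt.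
by move=> h hr; apply: xE; exact: box_norm.
Qed.

End chain.

Definition block_config k (w : code (st k)) (p : pos) : config d A :=
  fun v => dec w (at_pos p v).

(** The visited part of [x] lies in one block of high level, where [start_window] provides [m]
    disjoint blocks of level [k.+1] per axis. The lower bound obtained does not depend on [x]. *)
Lemma language_count k m L H r (psi : config d A -> bool) (x : config d A) :
  (forall y z, agree r y z -> psi y = psi z) -> tower_language x ->
  (H + r.*2 <= N k)%N -> (m.+1 * (N k.+1).+1 <= L.+1 * k`!)%N ->
  (m ^ d * (mult k * \sum_w \sum_(h : {ffun 'I_d -> 'I_H})
      psi (@block_config k w (fun i => h i + r))) <=
   \sum_(a : {ffun 'I_d -> 'I_L.+1})
      psi (shift_config (\row_i (a i * k`!)%:Z) x))%N.
Proof.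
move=> psi_r xL HN mL.
(* The radius covers the window and its margin [r], and it forces [K] to be at least [k.+1]. *)
have [K [rK [W [u [uN xE]]]]] := xL (r + L.+1 * k`! + k.+1)%N.
have [n KE] : exists n, K = (n + k.+1)%N.
  by exists (K - k.+1)%N; rewrite subnK// (leq_trans _ rK)// leq_addl.
subst K.
have win i : exists q : nat -> nat, forall j, (j < m)%N ->
    [/\ start filler sel k.+1 n (u i + q j), (q j + N k.+1 < m.+1 * (N k.+1).+1)%N &
        forall j', (j < j' < m)%N -> (q j + N k.+1 <= q j')%N].
  apply: start_window => //; have [_] := uN i; lia.
have [q qP] := choice win.
pose F (p : pos) := psi (shift_config (\row_i (p i)%:Z) x).
have -> : (\sum_(a : {ffun 'I_d -> 'I_L.+1})
      psi (shift_config (\row_i (a i * k`!)%:Z) x) =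
    #|finset (fun a : {ffun 'I_d -> 'I_L.+1} => F (fun i => a i * k`!))|)%N.
  rewrite -sum1_card [RHS]big_mkcond /=; apply: eq_bigr => a _.
  by rewrite inE /F; case: (psi _).
apply: (@window_count d A filler sel d_gt0 A_gt0 sel_ge3 k m L H r q F
  (fun w p => psi (@block_config k w p))).
- by move: HN; rewrite -addnn addnA; apply: leq_trans; rewrite leq_addr.
- by move=> i j jm; have [_ lt _] := qP i j jm; rewrite (leq_trans (ltnW lt)).
- move=> i j j' jj'; have jm : (j < m)%N by lia.
  by have [_ _] := qP i j jm; exact.
move=> j.
have [W' W'E] : exists W' : code (st k.+1), forall h, in_box (N k.+1) h ->
    dec W (fun i => u i + q i (j i) + h i)%N = dec W' h.
  by apply: start_dec => // i; have [] := qP i (j i) (ltn_ord (j i)).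
exists W' => c h; apply: psi_r => v vr.
have hN i : (at_pos (fun i => h i + r)%N v i < N k)%N.
  by rewrite /at_pos; have := vr i; have := ltn_ord (h i); lia.
have lt i : (g k * c i + N k <= N k.+1)%N.
  have cw : (c i < width k)%N.
    by rewrite (leq_trans (ltn_ord (c i)))// widthE.
  have := leq_mul cw (leqnn (g k)); have := sideS d_gt0 A_gt0 sel_ge3 k.
  have gE : g k = (N k + spacer (st k))%N by [].
  by rewrite mulSn [(c i * _)%N]mulnC; lia.
have qL i : (q i (j i) + N k.+1 <= L.+1 * k`!)%N.
  by have [_ /ltnW/leq_trans le _] := qP i (j i) (ltn_ord (j i)); exact: le.
rewrite /block_config -dec_cell// -W'E; last first.
  by move=> i; apply: leq_trans (lt i); rewrite ltn_add2l.
rewrite /shift_config xE.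
  congr (dec W _); apply/funext => i; rewrite /at_pos !mxE /=.
  by have := vr i; have := ltn_ord (h i); have [] := uN i; lia.
move=> i; rewrite !mxE /=; have := vr i; have := ltn_ord (h i); have := qL i.
by have := lt i; lia.
Qed.

End language.

Lemma bernoulli_sub (R : realDomainType) (x : R) n : 0 <= x <= 1 ->
  1 - x ^+ n <= n%:R * (1 - x).
Proof.
move=> /andP[x0 x1]; elim: n => [|n IH]; first by rewrite expr0 subrr mul0r.
have xn1 : x ^+ n <= 1 by exact: exprn_ile1.
rewrite exprS -[n.+1]addn1 natrD mulrDl mul1r.
apply: le_trans (lerD IH (lexx _)).
have : (1 - x) * (1 - x ^+ n) >= 0 by rewrite mulr_ge0// subr_ge0.
by nra.
Qed.

(** * Minimality and equidistribution of the tower *)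

Section ergodicity.
Variables (R : realType) (d : nat) (A : finType) (filler : A).
Variable sel : nat -> stage d A -> nat.
Hypothesis d_gt0 : (0 < d)%N.
Hypothesis A_gt0 : (0 < #|A|)%N.
Local Notation st := (st filler sel).
Hypothesis sel_ge3 : forall k, (3 <= sel k (st k))%N.
Local Notation width := (width filler sel).
Local Notation mult := (mult filler sel).
Local Notation N k := (side (st k)).
Local Notation g k := (gap (st k)).
Notation pos := ('I_d -> nat).
Local Notation Z := (tower_language filler sel).
Variables (x0 : config d A) (Zx0 : Z x0).
Notation X := (subshift R Zx0).
Let Zshift := @tower_language_shift d A filler sel.
Notation T := (@shift_action R d A Z x0 Zx0 Zshift).

Let countF k L (psi : config d A -> bool) (x : config d A) : nat :=
  (\sum_(a : {ffun 'I_d -> 'I_L.+1}) psi (shift_config (\row_i (a i * k`!)%:Z) x))%N.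

Lemma multiples_fact k m (a : 'I_d -> nat) : (0 < m <= k)%N ->
  multiples m (\row_i (a i * k`!)%:Z).
Proof.
move=> mk; have /dvdnP[e eE] := dvdn_fact mk.
exists (\row_i (a i * e)%:Z); apply/rowP => i; rewrite mulmxnE !mxE.
by rewrite eE mulnA PoszM -mulr_natr natz.
Qed.

Lemma tower_minimal (F : set 'rV[int]_d) :
  is_subgroup F -> finite_index F -> minimal T F.
Proof.
move=> sF /(finite_index_multiples sF)[m m0 mF] x.
apply: shift_dense => n z.
have [K [rK [W [u [uN zE]]]]] := point_ofP z (maxn n m).
set r := maxn n m in rK uN zE.
pose psi (y : config d A) := `[< agree n z y >].
have psi_loc y y' : agree r y y' -> psi y = psi y'.
  move=> yy'; have {}yy' : agree n y y' by apply: agree_le yy'; rewrite leq_maxl.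
  apply/asbool_equiv_eq; split => zy; first exact: agree_trans yy'.
  exact: agree_trans (agree_sym yy').
pose H := (N K - r.*2)%N.
have HN : (H + r.*2 <= N K)%N.
  by rewrite subnK//; have [] := uN (Ordinal d_gt0); rewrite -addnn; lia.
pose L := (2 * (N K.+1).+1).-1.
have LE : L.+1 = (2 * (N K.+1).+1)%N by [].
have := @language_count d A filler sel d_gt0 A_gt0 sel_ge3 K 1 L H r psi x psi_loc
  (point_ofP x) HN.
rewrite LE leq_pmulr ?fact_gt0// => /(_ isT); rewrite exp1n mul1n => le.
have : (0 < \sum_(w : code (st K)) \sum_(h : {ffun 'I_d -> 'I_H})
      psi (block_config w (fun i => h i + r)))%N.
  have uH i : (u i - r < H)%N by rewrite /H; have [] := uN i; rewrite -addnn; lia.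
  rewrite lt0n sum_nat_eq0; apply/forallPn; exists W; rewrite implyTb.
  rewrite sum_nat_eq0; apply/forallPn; exists [ffun i => Ordinal (uH i)].
  rewrite implyTb eqb0 negbK; apply/asboolP => h hn; rewrite zE; last first.
    by move=> i; rewrite (leq_trans (hn i))// leq_maxl.
  congr (dec W _); apply/funext => i; rewrite /at_pos ffunE /= subnK//.
  by have [] := uN i.
move=> s0; have : (0 < \sum_(a : {ffun 'I_d -> 'I_L.+1})
    psi (shift_config (\row_i (a i * K`!)%:Z) x))%N.
  apply: leq_trans le; rewrite muln_gt0 s0 andbT /mult muln_gt0 !expn_gt0.
  rewrite (code_gt0 d_gt0 A_gt0 sel_ge3) muln_gt0/= (leq_trans _ (sel_ge3 K))//=.
rewrite lt0n sum_nat_eq0 => /forallPn[a]; rewrite implyTb eqb0 negbK => /asboolP za.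
exists (\row_i (a i * K`!)%:Z); last exact: za.
by apply/mF/multiples_fact; rewrite m0 (leq_trans _ rK)// leq_maxr.
Qed.


(* The count of [language_count] is taken for [psi] and for its negation: together
   they leave room only for the proportion of positions near block boundaries. *)
Lemma tower_frequency k r (psi : config d A -> bool) :
  (forall y z, agree r y z -> psi y = psi z) -> (r.*2.+2 <= k)%N ->
  exists L (c : R), forall x, Z x ->
    `|(countF k L psi x)%:R / (L.+1 ^ d)%:R - c| <= d%:R * (r.*2 + 3)%:R / k.+1%:R.
Proof.
move=> psi_loc rk; have kN := side_gt d_gt0 A_gt0 sel_ge3 k.
pose H := (N k - r.*2)%N; have HE : (N k = H + r.*2)%N by rewrite /H; lia.
pose b := (#|code (st k)| * k.+1 * sel k (st k))%N.
have b0 : (0 < b)%N.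
  rewrite !muln_gt0/= (code_gt0 d_gt0 A_gt0 sel_ge3)/=.
  exact: leq_trans (sel_ge3 k).
have WE : width k = (b * k`!)%N by rewrite /width factS /b; lia.
have W0 : (0 < width k)%N by rewrite WE muln_gt0 b0 fact_gt0.
have kW : (k < width k)%N.
  rewrite WE /b; have := code_gt0 d_gt0 A_gt0 sel_ge3 k; have := sel_ge3 k.
  have := fact_gt0 k; move: (_`!) (sel _ _) #|_| => f t s f0 t3 s0.
  by rewrite -2!mulnA mulnCA leq_pmulr// !muln_gt0 s0 f0 andbT (leq_trans _ t3).
pose L := (b * (N k.+1).+1).-1.
have LE : L.+1 = (b * (N k.+1).+1)%N by rewrite prednK// muln_gt0 b0.
pose w := (width k).-1; have wE : w.+1 = width k by rewrite prednK.
pose B (psi : config d A -> bool) := (w ^ d * (mult k *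
  \sum_(v : code (st k)) \sum_(h : {ffun 'I_d -> 'I_H}) psi (block_config v (fun i => h i + r))))%N.
have low psi' x : (forall y z, agree r y z -> psi' y = psi' z) -> Z x ->
    (B psi' <= countF k L psi' x)%N.
  move=> loc' Zx; apply: language_count => //; first by rewrite -HE.
  by rewrite LE wE WE mulnAC.
pose B1 := (w * b * H)%N.
have BB : (B psi + B (fun y => ~~ psi y) = B1 ^ d)%N.
  rewrite /B -!mulnDr -big_split /=.
  under eq_bigr do rewrite -big_split /=.
  rewrite (eq_bigr (fun=> H ^ d)%N) => [|v _]; last first.
    rewrite (eq_bigr (fun=> 1%N)) => [|h _]; last by case: (psi _).
    by rewrite sum_nat_const card_ffun !card_ord muln1.
  rewrite sum_nat_const (mulnA (mult k)) [(mult k * #|_|)%N]mulnC.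
  by rewrite (mult_blocks filler sel d_gt0) -/b /B1 !expnMn mulnA.
have CC x : (countF k L psi x + countF k L (fun y => ~~ psi y) x = L.+1 ^ d)%N.
  rewrite /countF -big_split /= (eq_bigr (fun=> 1%N)) => [|a _]; last by case: (psi _).
  by rewrite sum_nat_const card_ffun !card_ord muln1.
have sE := sideS d_gt0 A_gt0 sel_ge3 k; have gE : g k = (N k + spacer (st k))%N by [].
have B1L : (B1 <= L.+1)%N.
  rewrite LE /B1 mulnAC mulnC leq_mul2l; apply/orP; right.
  have : (w * H <= w.+1 * g k)%N by rewrite leq_mul//; lia.
  by rewrite wE; lia.
have ratio : (k.+1 * L.+1 <= k.+1 * B1 + (r.*2 + 3) * L.+1)%N.
  have [e kE] : exists e, k.+1 = (r.*2 + 3 + e)%N.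
    by exists (k.+1 - (r.*2 + 3))%N; lia.
  have NX : ((N k.+1).+1 <= width k * (N k).+2)%N.
    have gN : (g k <= (N k).+1)%N by rewrite gE; case: (spacer _); rewrite /=; lia.
    have := leq_mul (leqnn (width k)) gN; rewrite mulnS [(width k * (N k).+2)%N]mulnS.
    by rewrite mulnS -sE; lia.
  (* One window in [width k] is lost, and at most [r.*2 + 2] positions in [(N k).+2]. As [width k]
     and [N k] exceed [k], the proportion lost per axis is at most [(r.*2 + 3) / k.+1]. *)
  have main : (e * (width k * (N k).+2) <= k.+1 * (w * H))%N.
    have [p HpE] : exists p, H = (3 + e + p)%N by exists (H - (3 + e))%N; lia.
    have [q wqE] : exists q, w = (r.*2 + 2 + e + q)%N by exists (w - (r.*2 + 2 + e))%N; lia.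
    rewrite -wE HE kE wqE HpE.
    pose K := (r.*2 + 3 + e)%N.
    rewrite (_ : (K * ((r.*2 + 2 + e + q) * (3 + e + p)) =
      e * ((r.*2 + 2 + e + q).+1 * (3 + e + p + r.*2).+2) +
      ((r.*2 + 2) * K * p + K * q + (r.*2 + 3) * (p * q) + r.*2 * K +
       2 * ((r.*2 + 3) * (K + q))))%N) ?leq_addr//.
    by rewrite /K -!mul2n; lia.
  rewrite {1}kE mulnDl addnC leq_add2r LE /B1.
  rewrite mulnCA [(w * b)%N]mulnC -[(b * w * H)%N]mulnA [(k.+1 * _)%N]mulnCA leq_mul2l.
  by apply/orP; right; apply: leq_trans main; rewrite leq_mul2l NX orbT.
have L0 : 0 < (L.+1)%:R :> R by rewrite ltr0n.
exists L, ((B psi)%:R / (L.+1 ^ d)%:R) => x Zx.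
rewrite -mulrBl normrM [X in _ * X]ger0_norm ?invr_ge0//.
have lowp := low psi x psi_loc Zx.
have lown : (B (fun y => ~~ psi y) <= countF k L (fun y => ~~ psi y) x)%N.
  by apply: low => // y z yz; rewrite (psi_loc _ _ yz).
rewrite ger0_norm ?subr_ge0 ?ler_nat//.
pose rho : R := B1%:R / L.+1%:R.
have rho01 : 0 <= rho <= 1.
  by rewrite divr_ge0//= ler_pdivrMr// mul1r ler_nat.
apply: (@le_trans _ _ (1 - rho ^+ d)).
  have hR : (countF k L psi x)%:R + (B1 ^ d)%:R <= (L.+1 ^ d)%:R + (B psi)%:R :> R.
    by rewrite -!natrD ler_nat -(CC x) -BB; lia.
  have Ld0 : (L.+1 ^ d)%:R != 0 :> R by rewrite natrX expf_neq0 ?gt_eqF.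
  rewrite ler_pdivrMr ?ltr0n ?expn_gt0// mulrBl mul1r /rho expr_div_n -!natrX.
  by rewrite divfK//; lra.
apply: le_trans (bernoulli_sub d rho01) _.
rewrite -mulrA ler_wpM2l// ler_pdivlMr ?ltr0n// mulrC.
rewrite -(ler_pM2r L0) mulrBr mulr1 mulrBl /rho mulrA mulfVK ?gt_eqF//.
by rewrite lerBlDr -!natrM -natrD ler_nat addnC.
Qed.

Lemma tower_equidistributed m (U : set X) : (0 < m)%N -> local_set U ->
  equidistributed_on Zshift (@multiples d m) U.
Proof.
move=> m0 [r rU] eps eps0.
pose psi (y : config d A) := `[< exists2 x : X, agree r y x & U x >].
have psi_loc y z : agree r y z -> psi y = psi z.
  move=> yz; apply/asbool_equiv_eq; split => -[x xr Ux]; exists x => //.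
    exact: agree_trans (agree_sym yz) xr.
  exact: agree_trans yz xr.
have psiE (x : X) : psi x = (x \in U).
  apply/asboolP/idP => [[z xz Uz]|/set_mem Ux]; last by exists x.
  by apply/mem_set; apply: rU Uz; exact: agree_sym.
pose C : R := d%:R * (r.*2 + 3)%:R.
pose k := (m + r.*2.+2 + Num.truncn (C / eps))%N.
have kC : C / k.+1%:R <= eps.
  rewrite ler_pdivrMr ?ltr0n// mulrC -ler_pdivrMr//.
  by rewrite (le_trans (ltW (truncnS_gt _)))// ler_nat ltnS leq_addl.
have rk : (r.*2.+2 <= k)%N by rewrite /k; lia.
have [L [c Lc]] := tower_frequency psi_loc rk.
pose e (a : {ffun 'I_d -> 'I_L.+1}) : 'rV[int]_d := \row_i (a i * k`!)%:Z.
exists [seq e a | a <- enum {: {ffun 'I_d -> 'I_L.+1}}], c.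
have sizeE : size [seq e a | a <- enum {: {ffun 'I_d -> 'I_L.+1}}] = (L.+1 ^ d)%N.
  by rewrite size_map -cardE card_ffun !card_ord.
split.
- by rewrite sizeE expn_gt0.
- move=> _ /mapP[a _ ->]; apply: (@multiples_fact k m (fun i => a i)).
  by rewrite m0 /k; lia.
move=> x; rewrite (le_trans _ kC)//; apply: le_trans (Lc x (point_ofP x)).
rewrite /average sizeE /countF natr_sum big_map big_enum /=.
rewrite (eq_bigr (fun a => (psi (shift_config (e a) x))%:R)) => [//|a _].
by rewrite indicE -psiE.
Qed.

Theorem tower_strictly_ergodic :
  totally_strictly_ergodic T /\
  exists mu : probability (borel X) R, unique_invariant T setT mu.
Proof.
have [mu muT muF] := equidistributed_uniquely_ergodic
  (@tower_language_closed d A filler sel) tower_equidistributed.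
split; last by exists mu.
by move=> F sF fF; split; [exact: tower_minimal|exact: muF].
Qed.

End ergodicity.

(** * Choice of the widths *)

(** Convexity of the power function between [a] and [a + 1]. *)
Lemma expr_interpolate (R : realDomainType) (a y : R) n : 0 <= a -> 0 <= y <= 1 ->
  (a + y) ^+ n <= (1 - y) * a ^+ n + y * (a + 1) ^+ n.
Proof.
move=> a0 /andP[y0 y1]; elim: n => [|n IH]; first by rewrite !expr0; lra.
rewrite exprS; have ay0 : 0 <= a + y by exact: addr_ge0.
apply: le_trans (ler_wpM2l ay0 IH) _; rewrite !exprS.
have ab : a ^+ n <= (a + 1) ^+ n by rewrite lerXn2r ?nnegrE ?addr_ge0// lerDl.
set p := a ^+ n in ab *; set q := (a + 1) ^+ n in ab *.
have : 0 <= y * ((1 - y) * (q - p)) by rewrite !mulr_ge0// subr_ge0.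
by nra.
Qed.

Section growth.
Variables (R : realType) (d : nat) (A : finType) (filler : A) (k : nat).
Variable s : stage d A.
Hypothesis d_gt1 : (1 < d)%N.
Hypothesis code_gt0 : (0 < #|code s|)%N.
Hypothesis gap_gt0 : (0 < gap s)%N.
Local Notation next_width t := (#|code s| * k.+1`! * t)%N.
Local Notation next_mult t := (#|code s| ^ d.-1 * (k.+1 * t) ^ d)%N.

Lemma next_width_gt0 t : (0 < t)%N -> (0 < next_width t)%N.
Proof. by move=> t0; rewrite !muln_gt0 code_gt0 fact_gt0. Qed.

Lemma next_width_ge t : (t <= next_width t)%N.
Proof. by rewrite leq_pmull// muln_gt0 code_gt0 fact_gt0. Qed.

Lemma side_step t : (0 < t)%N ->
  (side (step filler k s t) + spacer s = next_width t * gap s)%N.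
Proof.
move=> t0; rewrite /= prednK ?next_width_gt0// subnK//.
have := next_width_gt0 t0; case: (spacer s) => //= w0.
by rewrite muln_gt0 w0.
Qed.

Lemma next_multE t :
  (#|code s| * k`! ^ d * next_mult t = next_width t ^ d)%N.
Proof.
clear code_gt0 gap_gt0; rewrite mulnAC mulnA -expnS prednK ?(ltnW d_gt1)// -!expnMn factS.
by congr (_ ^ _)%N; lia.
Qed.

(** The strict inequality, with [gap] in place of [side] to charge for the filler, is an invariant.
    Of a main term of order [W ^ d], both the growth of the gap and the loss [c * ln l.+1] cost only
    order [W ^ d.-1], the latter because [ln l.+1 <= d * W] and [1 < d]. Thus the slack [lam] wins
    once [W] exceeds [D / lam]. *)
Lemma entropy_step (M : R) : 0 <= M ->
  M * (gap s ^ d)%:R < ln (#|code s|%:R : R) ->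
  exists t0, forall t, (t0 <= t)%N ->
    M * (gap (step filler k s t) ^ d)%:R <
    ln (#|code (step filler k s t)|%:R : R).
Proof.
move=> M0 Ms; have d0 : (0 < d)%N by exact: ltnW.
pose S := #|code s|; pose c : nat := (S * (k`! ^ d * S))%N.
pose lam : R := ln S%:R - M * (gap s ^ d)%:R.
have lam0 : 0 < lam by rewrite subr_gt0.
pose D : R := M * ((gap s)%:R + 1) ^+ d + (c * d)%:R.
have D0 : 0 <= D by rewrite addr_ge0// mulr_ge0// exprn_ge0// addr_ge0.
exists (Num.truncn (D / lam)).+1 => t tt.
have t0 : (0 < t)%N by exact: leq_trans tt.
pose W := next_width t; pose l := next_mult t.
have W0 : (0 < W)%N by exact: next_width_gt0.
have W0R : 0 < W%:R :> R by rewrite ltr0n.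
have DW : D < lam * W%:R.
  rewrite mulrC -ltr_pdivrMr//; apply: lt_le_trans (truncnS_gt _) _.
  by rewrite ler_nat (leq_trans tt)// next_width_ge.
pose y : R := W%:R^-1.
have y01 : 0 <= y <= 1 by rewrite invr_ge0 ler0n invf_le1// ler1n.
have gapS : (gap (step filler k s t) <= W * gap s + 1)%N.
  have := side_step t0; rewrite /gap -/W => <-.
  by rewrite [spacer (step _ _ _ _)]/=; case: (spacer s) => /=; lia.
have gap_le : M * (gap (step filler k s t) ^ d)%:R <=
    W%:R ^+ d * (M * (gap s ^ d)%:R + y * (M * ((gap s)%:R + 1) ^+ d)).
  have le1 : (gap (step filler k s t) ^ d)%:R <= W%:R ^+ d * ((gap s)%:R + y) ^+ d :> R.
    rewrite -exprMn mulrDr /y mulfV ?gt_eqF// natrX.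
    have le2 : (gap (step filler k s t))%:R <= W%:R * (gap s)%:R + 1 :> R.
      by rewrite -natrM -[1]/(1%:R) -natrD ler_nat.
    by apply: lerXn2r le2; rewrite nnegrE// addr_ge0// mulr_ge0.
  apply: le_trans (ler_wpM2l M0 le1) _.
  rewrite mulrCA ler_wpM2l ?exprn_ge0//.
  have := ler_wpM2l M0 (expr_interpolate d (ler0n _ (gap s)) y01).
  rewrite natrX => /le_trans; apply; rewrite mulrDr mulrCA [X in _ <= _ + X]mulrCA lerD2r.
  by rewrite mulrA [_ * M]mulrC -mulrA ler_wpM2l// ler_piMl ?exprn_ge0// lerBlDr lerDl; case/andP: y01.
have S0 : 0 < S%:R :> R by rewrite ltr0n.
have ln_le : (next_width t ^ d)%:R * ln S%:R - c%:R * ln l.+1%:R <=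
    ln (#|code (step filler k s t)|%:R : R).
  rewrite -(next_multE t) -/l -/S.
  have := @card_code_next d A filler d0 k s t l code_gt0 t0 erefl.
  set S' := #|code (step _ _ _ _)| => le.
  have S'0 : (0 < S')%N.
    case: (posnP S') le => // ->; rewrite muln0 leqn0 expn_eq0 -/S.
    by rewrite eqn0Ngt code_gt0.
  have : ln ((S ^ (l * (k`! ^ d * S)))%:R : R) <= ln ((l.+1 ^ c * S')%:R : R).
    by rewrite ler_ln ?posrE ?ltr0n ?muln_gt0 ?expn_gt0 ?code_gt0 ?ler_nat.
  rewrite natrM lnM ?posrE ?ltr0n ?expn_gt0// !natrX !lnXn ?ltr0n//.
  rewrite [(l * _)%N]mulnC [(k`! ^ d * S)%N]mulnC -[_ *+ _]mulr_natl -[_ *+ c]mulr_natl.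
  by rewrite lerBlDl.
have lnl : ln (l.+1%:R : R) <= d%:R * W%:R.
  have lW : (l.+1 <= W.+1 ^ d)%N.
    have le1 : (l <= W ^ d)%N.
      rewrite /W -next_multE -/l leq_pmull// muln_gt0 code_gt0 expn_gt0.
      by rewrite fact_gt0.
    by apply: leq_ltn_trans le1 _; rewrite ltn_exp2r.
  have : ln (l.+1%:R : R) <= ln ((W.+1 ^ d)%:R : R).
    by rewrite ler_ln ?posrE ?ltr0n ?expn_gt0// ler_nat.
  move=> /le_trans; apply; rewrite natrX lnXn ?ltr0n// -[_ *+ d]mulr_natl ler_wpM2l//.
  rewrite -[W.+1]add1n natrD; apply: le_ln1Dx.
  exact: lt_le_trans (ltrN10 _) (ler0n _ _).
apply: le_lt_trans gap_le _; apply: lt_le_trans ln_le.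
rewrite ltrBrDr; apply: (@le_lt_trans _ _ (W%:R ^+ d * (M * (gap s ^ d)%:R + y * D))).
  rewrite [y * D]mulrDr addrA [leRHS]mulrDr lerD2l.
  apply: le_trans (ler_wpM2l (ler0n _ c) lnl) _.
  have -> : W%:R ^+ d = W%:R * W%:R ^+ d.-1 :> R by rewrite -exprS prednK.
  rewrite mulrACA /y mulfV ?gt_eqF// mul1r.
  rewrite -natrX -!natrM ler_nat mulnA mulnC leq_mul2r; apply/orP; right.
  by rewrite -[leqLHS]expn1 leq_pexp2l// -ltnS prednK.
rewrite [(next_width t ^ d)%:R]natrX -/W ltr_pM2l ?exprn_gt0//.
by rewrite -ltrBrDl -/lam /y mulrC ltr_pdivrMr.
Qed.

End growth.

Lemma finite_zbox d (u : 'rV[int]_d) n : finite_set (zbox u (const_mx n)).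
Proof.
pose f (a : {ffun 'I_d -> 'I_n}) : 'rV[int]_d := \row_i (u ord0 i + (a i)%:Z).
apply: (@sub_finite_set _ _ (range f)); last exact: finite_image.
move=> v vo; have lt i : (absz (v ord0 i - u ord0 i) < n)%N.
  by have := vo i; rewrite mxE -[v 0 i]/(v ord0 i) -[u 0 i]/(u ord0 i); lia.
exists [ffun i => Ordinal (lt i)] => //; apply/rowP => i; rewrite mxE ffunE /=.
by have := vo i; rewrite mxE -[v 0 i]/(v ord0 i) -[u 0 i]/(u ord0 i); lia.
Qed.

Lemma banach_density0 (R : realType) d (P : set 'rV[int]_d) :
  upper_banach_density R P = 0%E -> forall delta : R, 0 < delta ->
  exists n0, forall n, (n0 <= n)%N -> forall u (s : seq 'rV[int]_d), uniq s ->
    (forall v, v \in s -> P v /\ zbox u (const_mx n) v) ->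
    (size s)%:R <= delta * (n ^ d)%:R.
Proof.
move=> P0 delta delta0.
have : (upper_banach_density R P < delta%:E)%E by rewrite P0 lte_fin.
rewrite /upper_banach_density /limf_esup => /ereal_inf_lt[_ [V [n0 _ n0V] <-] Vd].
(* The successor keeps [n], hence the volume, positive. *)
exists n0.+1 => n nn0 u s us sP.
have VN : V (const_mx n) by apply: n0V => i; rewrite mxE ltnW.
have nd0 : 0 < (n ^ d)%:R :> R by rewrite ltr0n expn_gt0 (leq_trans _ nn0).
have card_le : (size s <= #|` fset_set (P `&` zbox u (const_mx n))|)%N.
  apply: uniq_leq_size => // v vs; rewrite in_fset_set; last first.
    by apply: finite_setIr; exact: finite_zbox.
  by apply/mem_set; exact: sP.
rewrite -ler_pdivrMr//; apply: ltW; rewrite -lte_fin; apply: le_lt_trans Vd.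
apply: le_trans (ereal_sup_ubound _); last by exists (const_mx n).
apply: le_trans (ereal_sup_ubound _); last by exists u.
rewrite lee_fin (eq_bigr (fun=> n)) => [|i _]; last by rewrite mxE.
by rewrite prod_nat_const card_ord ler_pM2r ?invr_gt0// ler_nat.
Qed.

Section sparse.
Variables (R : realType) (d : nat) (A : finType) (filler : A) (k : nat).
Variable s : stage d A.
Variable P : set 'rV[int]_d.
Hypothesis d_gt1 : (1 < d)%N.
Hypothesis code_gt0 : (0 < #|code s|)%N.
Hypothesis gap_gt0 : (0 < gap s)%N.
Hypothesis P0 : upper_banach_density R P = 0%E.

(** The multiplicity is at least [side ^ d / C] with [C] independent of [t], so a density below
    [1 / (2 * C)] leaves P at most half of it. The extra 2 pays for two cells prescribed besides
    those that meet P, and is available since the multiplicity is at least 4. *)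
Lemma sparse_step : exists t0, forall t, (t0 <= t)%N ->
  forall u (l : seq 'rV[int]_d), uniq l ->
    (forall v, v \in l -> P v /\ zbox u (const_mx (side (step filler k s t))) v) ->
    (size l + 2 <= #|code s| ^ d.-1 * (k.+1 * t) ^ d)%N.
Proof.
pose C := (#|code s| * k`! ^ d * gap s ^ d)%N.
have C0 : (0 < C)%N by rewrite !muln_gt0 code_gt0 !expn_gt0 fact_gt0 gap_gt0.
have delta0 : 0 < (2 * C%:R)^-1 :> R by rewrite invr_gt0 mulr_gt0// ltr0n.
have [n0 n0P] := banach_density0 P0 delta0.
exists (n0 + 2)%N => t tt u l ul lP; set m := (_ * (k.+1 * t) ^ d)%N.
have t0 : (0 < t)%N by lia.
have sE := side_step filler k code_gt0 gap_gt0 t0.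
have wt := next_width_ge k code_gt0 t.
have mE := next_multE k s d_gt1 t; rewrite -/m in mE.
have [n nE] : exists n, side (step filler k s t) = n by eexists.
rewrite nE in lP sE; set w := (_ * t)%N in sE wt mE.
have n0n : (n0 <= n)%N.
  have : (w <= w * gap s)%N by rewrite leq_pmulr.
  by case: (spacer s) sE => /=; lia.
have := n0P _ n0n u l ul lP.
have : (n ^ d <= C * m)%N.
  rewrite /C mulnAC mE -expnMn; apply: leq_trans (_ : (w * gap s) ^ d <= _)%N => //.
  by rewrite leq_exp2r ?(ltnW d_gt1)// -sE leq_addr.
rewrite -(ler_nat R) => h1 h2.
have : (size l)%:R * 2 <= m%:R :> R.
  have C0R : 0 < C%:R :> R by rewrite ltr0n.
  move: h2; rewrite mulrC ler_pdivlMr ?mulr_gt0// => h2.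
  rewrite -(ler_pM2l C0R) -[leRHS]natrM; apply: le_trans h1; apply: le_trans h2.
  by rewrite mulrC -mulrA.
rewrite -natrM ler_nat => le2.
have : (4 <= m)%N.
  have S1 : (0 < #|code s| ^ d.-1)%N by rewrite expn_gt0 code_gt0.
  have : (2 ^ 2 <= (k.+1 * t) ^ d)%N.
    apply: (@leq_trans (2 ^ d)); first by rewrite leq_exp2l.
    by rewrite leq_exp2r ?(ltnW d_gt1)//; nia.
  by rewrite /m; move: S1; move: (_ ^ d.-1)%N => x x0 h; nia.
lia.
Qed.

End sparse.

(** * Points with an isolated letter *)

Definition row_of (d : nat) (p : 'I_d -> nat) : 'rV[int]_d := \row_i (p i)%:Z.

Section avoidance.
Variables (d : nat) (A : finType) (filler star : A).
Variable sel : nat -> stage d A -> nat.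
Hypothesis d_gt0 : (0 < d)%N.
Hypothesis A_gt0 : (0 < #|A|)%N.
Local Notation st := (st filler sel).
Hypothesis sel_ge3 : forall k, (3 <= sel k (st k))%N.
Local Notation width := (width filler sel).
Local Notation mult := (mult filler sel).
Local Notation N k := (side (st k)).
Local Notation g k := (gap (st k)).
Notation pos := ('I_d -> nat).
Variable P : set 'rV[int]_d.
Hypothesis filler_star : filler <> star.
Hypothesis letters : exists a b : A, [/\ a <> star, b <> star & a <> b].
Hypothesis sparse : forall k u (l : seq 'rV[int]_d), uniq l ->
  (forall v, v \in l -> P v /\ zbox u (const_mx (N k.+1)) v) ->
  (size l + 2 <= mult k)%N.

(** [u] is where the corner of the block sits in the group. *)
Definition avoids k (w : code (st k)) (u : 'rV[int]_d) :=
  forall p : pos, in_box (N k) p -> P (u + row_of p) -> dec w p <> star.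

Local Notation cellk k := (cell d (width k).-1).

Definition cell_pos k (c : cellk k) (h : pos) : pos := fun i => (g k * c i + h i)%N.

Definition hit_cells k (u : 'rV[int]_d) : {set cellk k} :=
  finset (fun c => `[< exists2 h, in_box (N k) h & P (u + row_of (cell_pos c h)) >]).

Let ones k : cellk k := [ffun=> inord 1].
Let zeros k : cellk k := [ffun=> ord0].

Lemma cell_pos_in_box k (c : cellk k) h : in_box (N k) h -> in_box (N k.+1) (cell_pos c h).
Proof.
move=> hN i; rewrite /cell_pos; have hi := hN i.
have cw : (c i < width k)%N.
  by rewrite (leq_trans (ltn_ord (c i)))// widthE.
have := leq_mul cw (leqnn (g k)); have := sideS d_gt0 A_gt0 sel_ge3 k.
have gE : g k = (N k + spacer (st k))%N by [].
by rewrite mulSn [(c i * _)%N]mulnC; lia.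
Qed.

Lemma cell_pos_inj k (c c' : cellk k) h h' : in_box (N k) h -> in_box (N k) h' ->
  cell_pos c h = cell_pos c' h' -> c = c'.
Proof.
move=> hN h'N E; apply/ffunP => i; apply: val_inj => /=.
have gh x : in_box (N k) x -> (x i < g k)%N.
  by move=> /(_ i) lt; apply: leq_trans lt (leq_addr _ _).
have := congr1 (fun p : pos => p i %/ g k)%N E; rewrite /cell_pos.
have g0 : (0 < g k)%N by exact: leq_ltn_trans (gh _ hN).
by rewrite ![(g k * _)%N]mulnC !divnMDl// !divn_small ?gh// !addn0.
Qed.

(** One point of [P] chosen in each hit cell gives a list to which [sparse] applies. *)
Lemma card_hit_cells k u : (#|hit_cells k u| + 2 <= mult k)%N.
Proof.
have hP (c : cellk k) : exists h, c \in hit_cells k u ->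
    in_box (N k) h /\ P (u + row_of (cell_pos c h)).
  have [cB|cB] := pselect (c \in hit_cells k u); last by exists (fun=> 0%N).
  by have := cB; rewrite inE => /asboolP[h hN Ph]; exists h.
have [h hhP] := choice hP.
pose f c := u + row_of (cell_pos c (h c)).
have := @sparse k u [seq f c | c <- enum (hit_cells k u)].
rewrite size_map -cardE; apply.
  rewrite map_inj_in_uniq ?enum_uniq// => c c'; rewrite !mem_enum => cB c'B.
  move=> /addrI E; have [hN _] := hhP c cB; have [h'N _] := hhP c' c'B.
  apply: (cell_pos_inj hN h'N); apply/funext => i.
  by have := congr1 (fun v : 'rV[int]_d => v ord0 i) E; rewrite !mxE => -[].
move=> v /mapP[c]; rewrite mem_enum => cB ->; have [hN Ph] := hhP c cB.
by split => // i; rewrite !mxE lerDl ltrD2l ltz_nat lez_nat cell_pos_in_box.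
Qed.

Lemma dec_filler_or_cell k (f : code (st k.+1)) (p : pos) : in_box (N k.+1) p ->
  dec f p = filler \/ exists c h, in_box (N k) h /\ p = cell_pos (c : cellk k) h.
Proof.
move=> pN; rewrite /= /next_dec; case: ifP => [/forallP H|_]; last by left.
right; exists [ffun i => inord (p i %/ g k)%N], (fun i => p i %% g k)%N; split=> //.
apply/funext => i; rewrite /cell_pos ffunE inordK; first by rewrite mulnC -divn_eq.
rewrite widthE// ltn_divLR ?gap_gt0//; have := pN i.
by have := sideS d_gt0 A_gt0 sel_ge3 k; lia.
Qed.

Lemma avoids_cells k (f : code (st k.+1)) u :
  (forall c, c \in hit_cells k u -> avoids (code_fun f c) (u + row_of (cell_pos c (fun=> 0%N)))) ->
  avoids f u.
Proof.
move=> fB p pN Pp; have [->//|[c [h [hN pE]]]] := dec_filler_or_cell f pN.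
have cB : c \in hit_cells k u by rewrite inE; apply/asboolP; exists h; rewrite -?pE.
rewrite pE /cell_pos dec_cell//; apply: fB cB _ hN _; move: Pp; rewrite pE.
congr P; rewrite -addrA; congr (_ + _); apply/rowP => i; rewrite !mxE /cell_pos.
by rewrite addn0 PoszD.
Qed.

Lemma hit_cells_extend k (u : 'rV[int]_d) (c1 c2 : cellk k) F :
  exists f : code (st k.+1), forall c, c \in c1 |: (c2 |: hit_cells k u) -> code_fun f c = F c.
Proof.
apply: code_extend => //; apply: leq_trans (card_hit_cells k u).
rewrite !cardsU1; have le1 (b : bool) : (b <= 1)%N by case: b.
by have := le1 (c1 \notin c2 |: hit_cells k u); have := le1 (c2 \notin hit_cells k u); lia.
Qed.

(** Two avoiding blocks are needed for the diagonal argument: whatever configuration is given, one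
    of them differs from it. They come from two letters other than [star], by changing a single cell
    at each level. *)
Lemma avoids_exists k u : exists w w' : code (st k),
  [/\ avoids w u, avoids w' u & exists2 p, in_box (N k) p & dec w p <> dec w' p].
Proof.
elim: k u => [|k IH] u.
  have [a [b [sa sb ab]]] := letters; exists a, b; split => //.
  by exists (fun=> 0%N).
have [w /choice[w' ww']] := choice (fun c : cellk k => IH (u + row_of (cell_pos c (fun=> 0%N)))).
have [f fE] := hit_cells_extend u (zeros k) (zeros k) w.
pose F c := if c == zeros k then w' c else w c.
have [f' f'E] := hit_cells_extend u (zeros k) (zeros k) F.
have zB : zeros k \in zeros k |: (zeros k |: hit_cells k u) by rewrite !inE eqxx.
exists f, f'; split.
- apply: avoids_cells => c cB; rewrite fE; last by rewrite !in_setU1 cB !orbT.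
  by have [] := ww' c.
- apply: avoids_cells => c cB; rewrite f'E; last by rewrite !in_setU1 cB !orbT.
  by rewrite /F; case: ifP => _; have [] := ww' c.
have [_ _ [h hN hE]] := ww' (zeros k).
exists (cell_pos (zeros k) h); first exact: cell_pos_in_box.
by rewrite /cell_pos !dec_cell// fE// f'E// /F eqxx.
Qed.

(** Cell 1 continues the block [v], while cell 0 is reserved for differing from [z]. *)
Lemma avoids_extend k (v : code (st k)) (u : 'rV[int]_d) (z : config d A) :
  avoids v (u + row_of (cell_pos (ones k) (fun=> 0%N))) ->
  exists f : code (st k.+1), [/\ code_fun f (ones k) = v, avoids f u &
    exists2 p, in_box (N k.+1) p & dec f p <> z (u + row_of p)].
Proof.
move=> va.
have [w /choice[w' ww']] := choice (fun c : cellk k => avoids_exists k (u + row_of (cell_pos c (fun=> 0%N)))).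
have [_ _ [h hN hE]] := ww' (zeros k).
have z1 : (zeros k == ones k) = false.
  apply/eqP => /ffunP/(_ (Ordinal d_gt0)); rewrite !ffunE => /(congr1 val) /=.
  by rewrite inordK// widthE//; have := width_ge3 d_gt0 A_gt0 sel_ge3 k; lia.
have [e [ea eh]] : exists e : code (st k), avoids e (u + row_of (cell_pos (zeros k) (fun=> 0%N))) /\
    dec e h <> z (u + row_of (cell_pos (zeros k) h)).
  have [wa w'a _] := ww' (zeros k).
  have [E|E] := pselect (dec (w (zeros k)) h = z (u + row_of (cell_pos (zeros k) h))).
    by exists (w' (zeros k)); split => // E'; apply: hE; rewrite E E'.
  by exists (w (zeros k)).
pose F c := if c == ones k then v else if c == zeros k then e else w c.
have [f fE] := hit_cells_extend u (zeros k) (ones k) F.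
exists f; split.
- by rewrite fE /F ?eqxx// !inE eqxx orbT.
- apply: avoids_cells => c cB; rewrite fE; last by rewrite !in_setU1 cB !orbT.
  rewrite /F; case: eqP => [->//|_]; case: eqP => [->//|_].
  by have [] := ww' c.
exists (cell_pos (zeros k) h); first exact: cell_pos_in_box.
rewrite {1}/cell_pos dec_cell// fE ?inE ?eqxx// /F z1 eqxx//.
Qed.

(** If [P] contained 0, the point x = T^0 x would lie in the closure to be avoided. *)
Hypothesis P_0 : ~ P 0.

(** Levels appear as [n + 0] because [chain_point] is used with [k0 = 0]. *)
Let corner n : 'rV[int]_d := - row_of (fun=> origin filler sel 0 n).

Let chain n := {w : code (st (n + 0)) | avoids w (corner n)}.

(** The passage from level [n] to level [n.+1] secures a disagreement with [e n], and later levels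
    keep it since they contain the block built so far. *)
Lemma diagonal_point (e : nat -> config d A) :
  exists x, [/\ tower_language filler sel x, x 0 = star,
    forall p, P p -> x p <> star & forall n, x <> e n].
Proof.
have w0 : avoids (star : code (st (0 + 0))) (corner 0).
  move=> p pN; suff -> : corner 0 + row_of p = 0 by [].
  apply/rowP => i; rewrite !mxE; have := pN i => /=.
  by case: (p i).
have step n (w : chain n) : {w' : chain n.+1 |
    code_fun (sval w' : code (st (n + 0).+1)) (ones (n + 0)) = sval w /\
    exists2 p, in_box (N (n + 0).+1) p & dec (sval w' : code (st (n + 0).+1)) p <> e n (corner n.+1 + row_of p)}.
  apply: cid; case: w => w wa.
  have [|f [fw fa fe]] := @avoids_extend (n + 0) w (corner n.+1) (e n).
    move=> p pN; have -> : corner n.+1 + row_of (cell_pos (ones (n + 0)) (fun=> 0%N)) = corner n.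
      apply/rowP => i; rewrite !mxE /cell_pos ffunE inordK; last first.
        by rewrite widthE//; have := width_ge3 d_gt0 A_gt0 sel_ge3 (n + 0); lia.
      by rewrite /= muln1 addn0; lia.
    exact: wa.
  by exists (exist _ f fa).
pose c0 : chain 0 := @exist _ (fun w : code (st (0 + 0)) => avoids w (corner 0)) star w0.
pose V := fix V n : chain n := if n is n'.+1 then sval (step n' (V n')) else c0.
have VS n := svalP (step n (V n)).
have [x Zx xE] := @chain_point d A filler sel d_gt0 A_gt0 sel_ge3 0 (fun n => sval (V n)) (fun n => (VS n).1).
have xrow n p : in_box (N (n + 0)) p -> x (corner n + row_of p) = dec (sval (V n)) p.
  move=> pN; rewrite (xE n); last first.
    by move=> i; rewrite !mxE /=; have := pN i; lia.
  congr (dec _ _); apply/funext => i; rewrite /at_pos !mxE /=; lia.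
exists x; split => //.
- by rewrite (xE 0%N) => // i; rewrite mxE.
- move=> v Pv; pose n := (\max_i `|v ord0 i|)%N.
  have vn i : (`|v ord0 i| <= n)%N by exact: (leq_bigmax (F := fun i => `|v ord0 i|%N)).
  pose p := at_pos (fun=> origin filler sel 0 n) v.
  have le1 := origin_ge d_gt0 A_gt0 sel_ge3 0 n.
  have le2 := origin_lt d_gt0 A_gt0 sel_ge3 0 n.
  have vE : v = corner n + row_of p.
    apply/rowP => i; rewrite !mxE /p /at_pos -[v 0 i]/(v ord0 i).
    by have := vn i; clearbody n; lia.
  have pN : in_box (N (n + 0)) p by move=> i; rewrite /p /at_pos; have := vn i; clearbody n; lia.
  rewrite vE xrow//; apply: (svalP (V n)) => //; by rewrite -vE.
- move=> n xe; have [_ [p pN pe]] := VS n; apply: pe.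
  rewrite -(xrow n.+1 p pN).
  exact: (congr1 (fun y : config d A => y (corner n.+1 + row_of p)) xe).
Qed.

End avoidance.

(** * Entropy *)

Section entropy.
Variables (R : realType) (d : nat) (A : finType) (filler : A).
Variable sel : nat -> stage d A -> nat.
Hypothesis d_gt0 : (0 < d)%N.
Hypothesis A_gt0 : (0 < #|A|)%N.
Local Notation st := (st filler sel).
Hypothesis sel_ge3 : forall k, (3 <= sel k (st k))%N.
Local Notation width := (width filler sel).
Local Notation mult := (mult filler sel).
Local Notation N k := (side (st k)).
Notation pos := ('I_d -> nat).
Local Notation cellk k := (cell d (width k).-1).

Lemma dec_injective k (w w' : code (st k)) : w <> w' ->
  exists2 p, in_box (N k) p & dec w p <> dec w' p.
Proof.
elim: k w w' => [|k IH] w w' ww'; first by exists (fun=> 0%N).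
have [c /IH[h hN hE]] : exists c, code_fun w c <> code_fun w' c.
  apply: contrapT => /forallNP E; apply: ww'; apply: val_inj; apply/ffunP => c.
  by apply: contrapT; exact: E.
exists (cell_pos c h); first exact: cell_pos_in_box.
by rewrite /cell_pos !dec_cell.
Qed.

Lemma mult_gt0 k : (0 < mult k)%N.
Proof.
rewrite /mult muln_gt0 !expn_gt0 (code_gt0 d_gt0 A_gt0 sel_ge3) muln_gt0.
by rewrite (leq_trans _ (sel_ge3 k)).
Qed.

Lemma block_point k (w : code (st k)) :
  exists2 x, tower_language filler sel x &
    forall p, in_box (N k) p -> x (row_of p) = dec w p.
Proof.
have ext n (v : code (st (n + k))) : {f : code (st (n + k).+1) |
    code_fun f [ffun=> inord 1] = v}.
  apply: cid.
  have [|f fE] := @code_extend d A filler sel d_gt0 A_gt0 sel_ge3 (n + k)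
      (finset.set1 [ffun=> inord 1]) (fun=> v).
    by rewrite cards1 mult_gt0.
  by exists f; rewrite fE// finset.in_set1.
pose W := fix W n : code (st (n + k)) := if n is n'.+1 then sval (ext n' (W n')) else w.
have [x Zx xE] := @chain_point d A filler sel d_gt0 A_gt0 sel_ge3 k W
  (fun n => svalP (ext n (W n))).
exists x => // p pN; rewrite (xE 0%N).
  by congr (dec w _); apply/funext => i; rewrite /at_pos mxE /=; lia.
move=> i; rewrite mxE -[(0 + k)%N]/k -[origin filler sel k 0]/0%N.
by rewrite add0r lez_nat ltz_nat; exact: pN.
Qed.

Variables (x0 : config d A) (Zx0 : tower_language filler sel x0).
Notation X := (subshift R Zx0).
Notation T := (@shift_action R d A _ x0 Zx0 (@tower_language_shift d A filler sel)).

(** Points with different letters at the origin are at distance at least 1, so the scale 1/2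
    separates points that show different blocks on the cube. *)
Lemma separation_number_ge k :
  ((#|code (st k)|%:R : R)%:E <= separation_number T (N k) (2^-1 : R))%E.
Proof.
have ptP (w : code (st k)) : exists x : X, forall p, in_box (N k) p -> x (row_of p) = dec w p.
  by have [x Zx xE] := block_point w; exists (Subshift R Zx0 Zx).
have [pt ptE] := choice ptP.
have pt_sep w w' : w <> w' -> exists2 v, zbox 0 (const_mx (N k)) v & pt w v <> pt w' v.
  move=> /dec_injective[p pN pE]; exists (row_of p).
    by move=> i; rewrite !mxE add0r /=; have := pN i; lia.
  by rewrite !ptE.
have pt_inj : injective pt.
  by move=> w w' E; apply: contrapT => /pt_sep[v _]; rewrite E.
apply: ereal_sup_ubound; exists (seq_fset tt [seq pt w | w <- enum (code (st k))]).
  move=> x y; rewrite !seq_fsetE => /mapP[w _ ->] /mapP[w' _ ->] /eqP ww'.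
  have [v vN vE] := pt_sep w w' (fun E => ww' (congr1 pt E)); exists v => //.
  rewrite ltNge; apply/negP => le; apply: vE.
  have : agree 0 (T v (pt w)) (T v (pt w')).
    by apply/(mdist_agree (R := R)); apply: le_lt_trans le _; rewrite invr1; lra.
  by move=> /(_ 0); rewrite !shift_actionE addr0; apply => i; rewrite mxE.
rewrite size_seq_fset undup_id; first by rewrite size_map -cardE.
by rewrite map_inj_uniq// enum_uniq.
Qed.

Lemma tower_entropy (M : R) :
  (forall k, M * (N k ^ d)%:R <= ln (#|code (st k)|%:R : R)) ->
  (M%:E <= topological_entropy T)%E.
Proof.
move=> MN; rewrite /topological_entropy.
apply: le_trans (ereal_sup_ubound _); last by exists 2^-1 => //=; rewrite invr_gt0.
rewrite /limn_esup /limf_esup; apply: le_ereal_inf_tmp => _ [V [n0 _ n0V] <-].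
apply: le_trans (ereal_sup_ubound _); last first.
  by exists (N n0) => //; apply: n0V => /=; apply: ltnW; exact: side_gt.
have N0 : 0 < (N n0 ^ d)%:R :> R.
  by rewrite ltr0n expn_gt0 side_gt0.
have c0 : 0 < #|code (st n0)|%:R :> R by rewrite ltr0n code_gt0.
apply: (@le_trans _ _ (((N n0 ^ d)%:R^-1 : R)%:E * lne (#|code (st n0)|%:R : R)%:E)%E).
  by rewrite lne_EFin// -EFinM lee_fin mulrC ler_pdivlMr.
apply: lee_wpmul2l; first by rewrite lee_fin invr_ge0 ltW.
have le := separation_number_ge n0.
rewrite lee_lne// in_itv/= leey andbT; first by rewrite lee_fin ltW.
by apply: le_trans le; rewrite lee_fin ltW.
Qed.

End entropy.

(** * Choice of the parameter and conclusion *)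

Lemma tower_exists (R : realType) (d : nat) (A : finType) (filler : A)
    (P : set 'rV[int]_d) (M : R) :
  (1 < d)%N -> upper_banach_density R P = 0%E -> 0 <= M -> M < ln (#|A|%:R) ->
  exists sel : nat -> stage d A -> nat,
    [/\ forall k, (3 <= sel k (st filler sel k))%N,
        forall k u (l : seq 'rV[int]_d), uniq l ->
          (forall v, v \in l -> P v /\ zbox u (const_mx (side (st filler sel k.+1))) v) ->
          (size l + 2 <= mult filler sel k)%N &
        forall k, M * (side (st filler sel k) ^ d)%:R <=
          ln (#|code (st filler sel k)|%:R : R)].
Proof.
move=> d1 P0 M0 MA; have d0 : (0 < d)%N by exact: ltnW.
have A0 : (0 < #|A|)%N by apply/card_gt0P; exists filler.
pose good k (s : stage d A) (t : nat) := [/\ (3 <= t)%N,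
  M * (gap (step filler k s t) ^ d)%:R < ln (#|code (step filler k s t)|%:R : R) &
  forall u (l : seq 'rV[int]_d), uniq l ->
    (forall v, v \in l -> P v /\ zbox u (const_mx (side (step filler k s t))) v) ->
    (size l + 2 <= #|code s| ^ d.-1 * (k.+1 * t) ^ d)%N].
have goodP k s : (0 < #|code s|)%N -> (0 < gap s)%N ->
    M * (gap s ^ d)%:R < ln (#|code s|%:R : R) -> exists t, good k s t.
  move=> c0 g0 Ms; have [t1 t1P] := entropy_step filler k d1 c0 g0 M0 Ms.
  have [t2 t2P] := sparse_step filler k d1 c0 g0 P0.
  exists (3 + t1 + t2)%N; split; [lia|apply: t1P; lia|apply: t2P; lia].
(* The maximum makes [3 <= sel] unconditional: this bound is needed before [good]
   is known to be satisfiable at every level. *)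
pose sel k (s : stage d A) := maxn 3 (xget 3%N (good k s)).
have sel3 k : (3 <= sel k (st filler sel k))%N by rewrite leq_maxl.
have invE k : M * (gap (st filler sel k) ^ d)%:R <
      ln (#|code (st filler sel k)|%:R : R) ->
    good k (st filler sel k) (sel k (st filler sel k)).
  move=> inv.
  have /(xgetPex 3%N) G := goodP k _ (code_gt0 d0 A0 sel3 k) (gap_gt0 d0 A0 sel3 k) inv.
  rewrite /sel; set t := xget _ _ in G *.
  by have [t3 _ _] := G; rewrite (maxn_idPr t3).
have inv k : M * (gap (st filler sel k) ^ d)%:R <
    ln (#|code (st filler sel k)|%:R : R).
  elim: k => [|k /invE[]//].
  by rewrite /gap /= addn0 exp1n mulr1.
exists sel; split => // k; first by have [] := invE k (inv k).
apply: ltW; apply: le_lt_trans (inv k); rewrite ler_wpM2l// ler_nat.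
by rewrite leq_exp2r// leq_addr.
Qed.

Theorem theorem1p3 (R : realType) (d : nat) (hd : (1 < d)%N)
    (P : set 'rV[int]_d) (hP0 : ~ P 0)
    (hP : upper_banach_density R P = 0%E)
    (M : R) (hM : 0 <= M) :
  exists (X : pmetricType R) (T : 'rV[int]_d -> X -> X)
         (mu : probability (borel X) R) (X0 : set X),
    [/\ compact [set: X],
        is_action T,
        totally_strictly_ergodic T /\ unique_invariant T [set: 'rV[int]_d] mu,
        ~ countable X0 /\
          (forall x, X0 x -> ~ closure [set T p x | p in P] x)
      & (M%:E <= topological_entropy T)%E].
Proof.
have d0 : (0 < d)%N by exact: ltnW.
(* [q.+1] exceeds the exponential of [M]; a size of at least three leaves two letters besides
   [star]. *)
pose q := Num.truncn (expR M); pose A := 'I_(q.+3).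
have MA : M < ln (#|{: A}|%:R : R).
  rewrite card_ord -[ltLHS]expRK ltr_ln ?posrE ?expR_gt0 ?ltr0n//.
  by apply: (lt_le_trans (truncnS_gt _)); rewrite ler_nat ltnW// ltnW.
pose star : A := ord0; pose filler : A := inord 1.
have filler_star : filler <> star by move=> /(congr1 val); rewrite /= inordK.
have letters : exists a b : A, [/\ a <> star, b <> star & a <> b].
  exists filler, (inord 2); split => //.
    by move=> /(congr1 val); rewrite /= inordK.
  by move=> /(congr1 val); rewrite /= !inordK.
have [sel [sel3 sparse ent]] := @tower_exists R d A filler P M hd hP hM MA.
have A0 : (0 < #|{: A}|)%N by rewrite card_ord.
have diag := @diagonal_point d A filler star sel d0 A0 sel3 P filler_star letters sparse hP0.
(* Any sequence would do: only a base point is wanted here. *)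
have [x0 [Zx0 _ _ _]] := diag (fun _ _ => star).
pose X := subshift R Zx0.
pose T := @shift_action R d A _ x0 Zx0 (@tower_language_shift d A filler sel).
have [Terg [mu muT]] := @tower_strictly_ergodic R d A filler sel d0 A0 sel3 x0 Zx0.
pose X0 : set X := [set x : X | x 0 = star /\ forall p, P p -> x p <> star].
exists X, T, mu, X0; split => //.
- by apply: subshift_compact; exact: tower_language_closed.
- exact: shift_is_action.
- split.
    move=> /countable_injP[f f_inj].
    (* [e] would list a countable [X0], with a default point at the numbers that [f] does not reach;
       a diagonal point escapes the list. *)
    pose e n : X := xget point [set x : X | X0 x /\ f x = n].
    have [x [Zx xstar xP xe]] := diag (fun n => e n).
    pose y : X := Subshift R Zx0 Zx; have X0y : X0 y by [].
    have [X0e fe] : X0 (e (f y)) /\ f (e (f y)) = f y.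
      by apply: (@xgetPex _ point [set z : X | X0 z /\ f z = f y]); exists y.
    apply: (xe (f y)).
    by rewrite (f_inj _ _ (mem_set X0e) (mem_set X0y) fe).
  (* To carry [star] at the origin is an open condition, and [T p x] carries [x p] there. *)
  move=> x [xstar xP] /(_ [set y : X | y 0 = star]) [].
    apply/nbhs_subshiftP; exists 0%N => y xy /=.
    by rewrite -xy// => i; rewrite mxE.
  move=> _ [[p Pp <-]] /=; rewrite /shift_config addr0; exact: xP.
exact: tower_entropy.
Qed.
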